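(* For $1<p<\infty$ let $p'=p/(p-1)$ and $p^*=\max\{p,p'\}$, and let $\mathcal{H}^{(p)}$ be the Haar system in $L_p=L_p[0,1]$. Then, for $1<p<\infty$, \[ \Delta_b[\mathcal{H}^{(p)},L_p]\approx\Delta_s[\mathcal{H}^{(p)},L_p]\approx\Delta_{sd}[\mathcal{H}^{(p)},L_p]\approx\Delta[\mathcal{H}^{(p)},L_p]\approx\Delta_d[\mathcal{H}^{(p)},L_p]\approx p^*. \] Here $\alpha_p\approx\beta_p$ for $1<p<\infty$ means that there are constants $0<c\le C<\infty$, independent of $p$, with $c\,\beta_p\le\alpha_p\le C\,\beta_p$ for all $1<p<\infty$.
   Context: Scalars are $\mathbb{F}=\mathbb{R}$ or $\mathbb{C}$. Haar system. Let $\mathcal{D}$ be the collection of all dyadic intervals $I=[a,b)$ contained in $[0,1)$, and let $\mathcal{D}_0=\mathcal{D}\cup\{0\}$. The Haar system is $\mathcal{H}^{(p)}=(h_I^{(p)})_{I\in\mathcal{D}_0}$, where $h_0^{(p)}$ is the constant function $1$ on $[0,1)$ and, for $I=[a,b)\in\mathcal{D}$, $h_I^{(p)}$ is supported on $I$, equals $-(b-a)^{-1/p}$ on $[a,(a+b)/2)$ and equals $(b-a)^{-1/p}$ on $[(a+b)/2,b)$. It is a normalized $M$-bounded (Markushevich) basis of $L_p$, with coordinate functionals $\mathcal{H}^{(p')}$ (under the canonical identification of $L_{p'}$ with $(L_p)^*$). Constants. Let $\mathcal{B}=(\mathbf{x}_j)_{j\in J}$ be a basis of a Banach space $\mathbb{X}$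 with coordinate functionals $(\mathbf{x}_j^* )_{j\in J}$. All sets $A,B$ below are finite subsets of $J$. - $\Delta[\mathcal{B},\mathbb{X}]$ (democracy constant) is the smallest $C$ such that $\|\sum_{j\in A}\mathbf{x}_j\|\le C\|\sum_{j\in B}\mathbf{x}_j\|$ whenever $|A|=|B|$; $\Delta_d[\mathcal{B},\mathbb{X}]$ is the smallest such $C$ under the extra requirement $A\cap B=\emptyset$. - $\Delta_s[\mathcal{B},\mathbb{X}]$ (superdemocracy constant) is the smallest $C$ such that $\|\sum_{j\in A}\varepsilon_j\mathbf{x}_j\|\le C\|\sum_{j\in B}\delta_j\mathbf{x}_j\|$ whenever $|A|=|B|$ and $\varepsilon_j,\delta_j\in\mathbb{F}$ with $|\varepsilon_j|=|\delta_j|=1$; $\Delta_{sd}[\mathcal{B},\mathbb{X}]$ is the smallest such $C$ under the extra requirement $A\cap B=\emptyset$. - $\Delta_b[\mathcal{B},\mathbb{X}]$ (bi-democracy constant) is the smallest $C$ such that $\|\sum_{j\in A}\mathbf{x}_j\|\,\|\sum_{k\in B}\mathbf{x}_k^*\|\le Cm$ whenever $|A|=|B|=m\in\mathbb{N}$. *)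

(* Defs.v *)
From HB Require Import structures.
From mathcomp Require Import all_boot all_order all_algebra finmap.
From mathcomp Require Import complex.
From mathcomp Require Import all_classical all_reals all_analysis.

Set Implicit Arguments.
Unset Strict Implicit.
Unset Printing Implicit Defensive.

Import Order.TTheory GRing.Theory Num.Theory.
Import numFieldNormedType.Exports.

Local Open Scope classical_set_scope.
Local Open Scope ring_scope.

Inductive scalars := RealScalars | ComplexScalars.

Section ScalarField.
Context (R : realType).

Definition scalar_field (F : scalars) : numFieldType :=
  match F with
  | RealScalars => (R : numFieldType)
  | ComplexScalars => (R[i] : numFieldType)
  end.

(* On R[i] the MathComp norm takes its values in R[i]. *)
Definition modulus (F : scalars) : scalar_field F -> R :=
  match F return scalar_field F -> R with
  | RealScalars => fun z : R => `|z|
  | ComplexScalars => fun z : R[i] => complex.Re `|z|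
  end.

Definition of_real (F : scalars) : R -> scalar_field F :=
  match F return R -> scalar_field F with
  | RealScalars => fun t : R => t
  | ComplexScalars => fun t : R => (t%:C)%C
  end.

Definition scalar_measurable d (T : measurableType d) (F : scalars) :
    (T -> scalar_field F) -> Prop :=
  match F return (T -> scalar_field F) -> Prop with
  | RealScalars => fun f : T -> R => measurable_fun setT f
  | ComplexScalars => fun f : T -> R[i] =>
      measurable_fun setT (fun t => complex.Re (f t)) /\
      measurable_fun setT (fun t => complex.Im (f t))
  end.

Definition scalar_integral d (T : measurableType d)
    (mu : {measure set T -> \bar R}) (F : scalars) :
    (T -> scalar_field F) -> scalar_field F :=
  match F return (T -> scalar_field F) -> scalar_field F with
  | RealScalars => fun f : T -> R => (\int[mu]_t f t)%R
  | ComplexScalars => fun f : T -> R[i] =>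
      ((\int[mu]_t complex.Re (f t))%R +i* (\int[mu]_t complex.Im (f t))%R)%C
  end.

End ScalarField.

(* The space is given as a set X of vectors of V with a seminorm N on X
   (for L_p: functions rather than classes modulo equality a.e.).
   x is the basis and xs its family of coordinate functionals. *)
Section Constants.
Context (R : realType) (F : scalars) (V : lmodType (scalar_field R F)).
Variables (X : set V) (N : V -> \bar R).
Variables (J : choiceType) (x : J -> V) (xs : J -> V -> scalar_field R F).

Definition dual_norm (phi : V -> scalar_field R F) : \bar R :=
  ereal_sup [set (modulus (phi f))%:E | f in [set f | X f /\ (N f <= 1)%E]].

(* The smallest C with P C, +oo if there is none. *)
Definition smallest_constant (P : R -> Prop) : \bar R :=
  ereal_inf [set C%:E | C in [set C : R | 0 <= C /\ P C]].

Definition unimodular (eps : J -> scalar_field R F) : Prop :=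
  forall j, modulus (eps j) = 1.

Definition democracy : \bar R := smallest_constant (fun C =>
  forall A B : {fset J}, #|` A| = #|` B| ->
    (N (\sum_(j <- A) x j)%R <= C%:E * N (\sum_(j <- B) x j)%R)%E).

Definition disjoint_democracy : \bar R := smallest_constant (fun C =>
  forall A B : {fset J}, #|` A| = #|` B| -> [disjoint A & B]%fset ->
    (N (\sum_(j <- A) x j)%R <= C%:E * N (\sum_(j <- B) x j)%R)%E).

Definition superdemocracy : \bar R := smallest_constant (fun C =>
  forall (A B : {fset J}) (eps delta : J -> scalar_field R F),
    #|` A| = #|` B| -> unimodular eps -> unimodular delta ->
    (N (\sum_(j <- A) eps j *: x j)%R
       <= C%:E * N (\sum_(j <- B) delta j *: x j)%R)%E).

Definition disjoint_superdemocracy : \bar R := smallest_constant (fun C =>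
  forall (A B : {fset J}) (eps delta : J -> scalar_field R F),
    #|` A| = #|` B| -> [disjoint A & B]%fset ->
    unimodular eps -> unimodular delta ->
    (N (\sum_(j <- A) eps j *: x j)%R
       <= C%:E * N (\sum_(j <- B) delta j *: x j)%R)%E).

Definition bidemocracy : \bar R := smallest_constant (fun C =>
  forall (A B : {fset J}) (m : nat), #|` A| = m -> #|` B| = m ->
    (N (\sum_(j <- A) x j)%R * dual_norm (fun f => (\sum_(k <- B) xs k f)%R)
       <= (C * m%:R)%R%:E)%E).

End Constants.

Section Haar.
Context (R : realType).

(* The pair (n, k) with k < 2 ^ n stands for [k / 2 ^ n, (k + 1) / 2 ^ n). *)
Definition dyadic := {n : nat & 'I_(2 ^ n)}.

Definition left_end (Q : dyadic) : R := (tagged Q)%:R / 2 ^+ tag Q.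
Definition right_end (Q : dyadic) : R := (tagged Q).+1%:R / 2 ^+ tag Q.

(* None is the extra index 0. *)
Definition haar_index : choiceType := option dyadic.

Definition haar (p : R) (i : haar_index) (t : R) : R :=
  match i with
  | None => if 0 <= t < 1 then 1 else 0
  | Some Q =>
      let a := left_end Q in
      let b := right_end Q in
      if a <= t < (a + b) / 2 then - ((b - a) `^ (- p^-1))
      else if (a + b) / 2 <= t < b then (b - a) `^ (- p^-1)
      else 0
  end.

Definition unit_interval_measure :=
  mrestr (@lebesgue_measure R) (measurable_itv `[0, 1]).

Context (F : scalars).

Definition Lp_norm (p : R) (f : R -> (scalar_field R F)^o) : \bar R :=
  'N[unit_interval_measure]_p%:E[(fun t => (modulus (f t))%:E)]%E.

Definition Lp (p : R) : set (R -> (scalar_field R F)^o) :=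
  [set f | @scalar_measurable R _ (measurableTypeR R) F f /\ (Lp_norm p f < +oo)%E].

Definition conj_exponent (p : R) : R := p / (p - 1).

Definition haar_system (p : R) (i : haar_index) : R -> (scalar_field R F)^o :=
  fun t => of_real F (haar p i t).

Definition haar_coord (p : R) (i : haar_index) (f : R -> (scalar_field R F)^o) :
    scalar_field R F :=
  scalar_integral unit_interval_measure
    (fun t => f t * haar_system (conj_exponent p) i t).

Definition haar_democracy (p : R) : \bar R :=
  democracy (Lp_norm p) (haar_system p).
Definition haar_disjoint_democracy (p : R) : \bar R :=
  disjoint_democracy (Lp_norm p) (haar_system p).
Definition haar_superdemocracy (p : R) : \bar R :=
  superdemocracy (Lp_norm p) (haar_system p).
Definition haar_disjoint_superdemocracy (p : R) : \bar R :=
  disjoint_superdemocracy (Lp_norm p) (haar_system p).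
Definition haar_bidemocracy (p : R) : \bar R :=
  bidemocracy (Lp p) (Lp_norm p) (haar_system p) (haar_coord p).

End Haar.

Definition approx_upto_constants (R : realType) (alpha beta : R -> \bar R) : Prop :=
  exists c C : R, [/\ 0 < c, c <= C &
    forall p : R, 1 < p ->
      (c%:E * beta p <= alpha p)%E /\ (alpha p <= C%:E * beta p)%E].

(* Main.v *)
Require Import Defs.
From HB Require Import structures.
From mathcomp Require Import all_boot all_order all_algebra finmap.
From mathcomp Require Import complex.
From mathcomp Require Import all_classical all_reals all_analysis.
From mathcomp Require Import measurable_realfun.
From mathcomp Require Import ring lra.

Set Implicit Arguments.
Unset Strict Implicit.
Unset Printing Implicit Defensive.

Import Order.TTheory GRing.Theory Num.Theory.

Local Open Scope classical_set_scope.
Local Open Scope ring_scope.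

(** Write [p'] for the conjugate exponent and [m] for the number of terms.
    All five constants lie between fixed multiples of [max p p'].

    Upper bounds.  At a point [t] the nonzero values [|h_j t|] with [j] in a
    finite set are powers of [2 `^ (1/p)], each taken at most twice, so their
    sum is a geometric sum, at most [8 * p] times its largest term
    ([sum_normr_haar_le]).  Bounding the [p]-th power of the largest term by
    the sum of the [p]-th powers and integrating, every unimodular sum of [m]
    Haar functions has norm at most [8 * p * m `^ (1/p)]
    ([Lp_norm_haar_sum_le]).  The same bound for [p'] controls the dual norms,
    and by biorthogonality and Hoelder it yields the lower bound
    [m `^ (1/p) / (16 * p')] for unimodular sums ([Lp_norm_haar_sum_ge]).
    Hence superdemocracy and bi-democracy hold with constants of order
    [p * p' = p + p'], which is at most twice [max p p'].

    Lower bounds.  A bi-democracy constant is a democracy constant, because the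
    normalized sum over [B] is a competitor in the dual norm
    ([haar_democracy_le_bidemocracy]); so only disjoint democracy has to be
    bounded from below.  The test families are [n] intervals of one level,
    whose Haar functions have disjoint supports and a sum of norm exactly
    [n `^ (1/p)], and the chain [[1 - 2^-k, 1)], [k < n].  For [p >= 2] and
    [n] about [p], the chain sum is at least [n] on an interval of measure
    [2^-n], so its norm is at least a multiple of [p] ([Lnorm_chain_ge]), while
    the other norm stays bounded.  For [p < 2] the chain sum telescopes up to the
    factor [2 - 2 `^ (1/p)], of order [1/p'], and for [n >= p'^2] its norm is at
    most a multiple of [n `^ (1/p) / p'] ([Lnorm_chain_le]). *)

(** * Dyadic indicators and the Haar functions *)
Section DyadicIndicators.
Context (R : realType).
Implicit Types (p q t : R) (n m k l : nat) (i j : haar_index).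

(** The constant function is given the level and the position of [[0, 1)], the
    interval that supports it. *)
Definition level j : nat := if j is Some Q then tag Q else 0.

Definition position j : nat := if j is Some Q then tagged Q else 0.

Definition dyadic_itv n k : set R :=
  [set` `[k%:R / 2 ^+ n, k.+1%:R / 2 ^+ n[ ].

Definition chi n k : R -> R := \1_(dyadic_itv n k).

Lemma mem_dyadic_itv n k t :
  (t \in dyadic_itv n k) = (k%:R <= t * 2 ^+ n < k.+1%:R).
Proof.
rewrite mem_setE in_itv/= ler_pdivrMr ?exprn_gt0//.
by rewrite ltr_pdivlMr ?exprn_gt0.
Qed.

(** Dyadic intervals are nested or disjoint: the interval of level [n] around a
    point is determined by the one of any finer level. *)
Lemma dyadic_itv_nested n m k l t : (n <= m)%N -> t \in dyadic_itv m l ->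
  (t \in dyadic_itv n k) = (k == l %/ 2 ^ (m - n))%N.
Proof.
move=> nm; rewrite !mem_dyadic_itv => /andP[lt tl].
have D0 : (0 < 2 ^ (m - n))%N by rewrite expn_gt0.
have tE : t * 2 ^+ m = t * 2 ^+ n * (2 ^ (m - n))%:R.
  by rewrite natrX -mulrA -exprD subnKC.
rewrite eqn_leq leq_divRL// -(ltnS (l %/ _)) ltn_divLR//.
have DR : 0 < (2 ^ (m - n))%:R :> R by rewrite ltr0n.
rewrite tE in lt tl; apply/andP/andP => -[a b]; split.
- rewrite -ltnS -(ltr_nat R) natrM; apply: le_lt_trans tl.
  by rewrite ler_pM2r.
- rewrite -(ltr_nat R) natrM; apply: le_lt_trans lt _.
  by rewrite ltr_pM2r.
- rewrite -(ler_pM2r DR); apply: le_trans lt.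
  by rewrite -natrM ler_nat.
- rewrite -(ltr_pM2r DR); apply: lt_le_trans tl _.
  by rewrite -natrM ler_nat.
Qed.

Lemma chiM n m k l t : (n <= m)%N ->
  chi n k t * chi m l t = (k == l %/ 2 ^ (m - n))%N%:R * chi m l t.
Proof.
move=> nm; rewrite /chi !indicE.
have [tl|] := boolP (t \in dyadic_itv m l); last by rewrite !mulr0.
by rewrite (dyadic_itv_nested _ nm tl) !mulr1.
Qed.

Lemma chi_ge0 n k t : 0 <= chi n k t.
Proof. by rewrite /chi indicE ler0n. Qed.

Lemma chi_halves n k t : chi n.+1 k.*2.+1 t + chi n.+1 k.*2 t = chi n k t.
Proof.
rewrite /chi !indicE !mem_dyadic_itv exprS mulrCA.
set x := t * _.
rewrite -(natr1 k.*2.+1) -(natr1 k.*2) -(natr1 k) -addnn natrD.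
have -> : (k%:R <= x) = (k%:R + k%:R <= 2 * x) by apply/idP/idP; lra.
have -> : (x < k%:R + 1) = (2 * x < k%:R + k%:R + 1 + 1) by apply/idP/idP; lra.
have [h1|h1] := leP (k%:R + k%:R + 1) (2 * x);
have [h2|h2] := leP (k%:R + k%:R) (2 * x);
have [h3|h3] := ltP (2 * x) (k%:R + k%:R + 1 + 1) => /=; lra.
Qed.

(** The absolute value of a Haar function of level [n] on its support. *)
Definition haar_scale p n : R := (2 ^+ n) `^ p^-1.

Lemma haar_scale_gt0 p n : 0 < haar_scale p n.
Proof. by rewrite powR_gt0// exprn_gt0. Qed.

Lemma haar_scale_exp p n : haar_scale p n = (2 `^ p^-1) ^+ n.
Proof.
rewrite /haar_scale -(powR_mulrn n (ler0n R 2)) -powRrM mulrC powRrM.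
by rewrite powR_mulrn// powR_ge0.
Qed.

Lemma haar_scale_powR p n : p != 0 -> haar_scale p n `^ p = 2 ^+ n.
Proof. by move=> p0; rewrite /haar_scale -powRrM mulVf// powRr1// exprn_ge0. Qed.

Lemma haar_scale_conj p q n : p^-1 + q^-1 = 1 ->
  haar_scale p n * haar_scale q n = 2 ^+ n.
Proof.
move=> pq; rewrite /haar_scale -powRD pq ?powRr1 ?exprn_ge0//.
by rewrite oner_eq0.
Qed.

Lemma haar_NoneE p t : haar p None t = chi 0 0 t.
Proof.
rewrite /chi indicE mem_dyadic_itv expr0 mulr1 /=.
by case: ifP.
Qed.

Lemma haar_SomeE p (Q : dyadic) t : haar p (Some Q) t =
  haar_scale p (tag Q) * (chi (tag Q).+1 (tagged Q).*2.+1 t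
                     - chi (tag Q).+1 (tagged Q).*2 t).
Proof.
case: Q => n k; rewrite /haar /left_end /right_end /=.
have e0 : (0 : R) < 2 ^+ n by rewrite exprn_gt0.
have -> : (k.+1%:R / 2 ^+ n - k%:R / 2 ^+ n) `^ (- p^-1) = haar_scale p n.
  rewrite -mulrBl -natr1 addrAC subrr add0r mul1r -powR_inv1 ?ltW// -powRrM.
  by rewrite mulN1r opprK.
rewrite /chi !indicE !mem_dyadic_itv exprS mulrCA.
have -> : (k%:R / 2 ^+ n + k.+1%:R / 2 ^+ n) / 2 = (k%:R + 2^-1) / 2 ^+ n :> R.
  rewrite -natr1; by field; rewrite gt_eqF.
rewrite !(ler_pdivrMr _ _ e0) !(ltr_pdivlMr _ _ e0).
set x := t * _.
rewrite -(natr1 k.*2.+1) -(natr1 k.*2) -(natr1 k) -addnn natrD.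
have -> : (k%:R <= x) = (k%:R + k%:R <= 2 * x) by apply/idP/idP; lra.
have -> : (x < k%:R + 1) = (2 * x < k%:R + k%:R + 1 + 1) by apply/idP/idP; lra.
have -> : (k%:R + 2^-1 <= x) = (k%:R + k%:R + 1 <= 2 * x).
  by apply/idP/idP; lra.
have -> : (x < k%:R + 2^-1) = (2 * x < k%:R + k%:R + 1).
  by apply/idP/idP; lra.
have [h1|h1] := leP (k%:R + k%:R + 1) (2 * x);
have [h2|h2] := leP (k%:R + k%:R) (2 * x);
have [h3|h3] := ltP (2 * x) (k%:R + k%:R + 1 + 1) => /=;
  rewrite ?subrr ?subr0 ?sub0r ?mulr0 ?mulr1 ?mulrN1 //; lra.
Qed.

Lemma normr_haar p j t :
  `|haar p j t| = haar_scale p (level j) * chi (level j) (position j) t.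
Proof.
case: j => [[n k]|]; last first.
  by rewrite haar_NoneE /haar_scale expr0 powR1 mul1r ger0_norm// chi_ge0.
rewrite haar_SomeE /= normrM gtr0_norm ?haar_scale_gt0//; congr (_ * _).
rewrite -(chi_halves n k t).
have := @chiM n.+1 n.+1 k.*2.+1 k.*2 t (leqnn _).
rewrite subnn expn0 divn1 gtn_eqF// mul0r.
move: (chi_ge0 n.+1 k.*2.+1 t) (chi_ge0 n.+1 k.*2 t).
set a := chi _ _ _; set b := chi _ _ _ => a0 b0 /eqP.
rewrite mulf_eq0 => /orP[] /eqP ->.
  by rewrite sub0r add0r normrN ger0_norm.
by rewrite subr0 addr0 ger0_norm.
Qed.

Lemma normr_haar_powR p j t : 0 < p ->
  `|haar p j t| `^ p = 2 ^+ level j * chi (level j) (position j) t.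
Proof.
move=> p0; rewrite normr_haar /chi indicE; case: (t \in _); last first.
  by rewrite !mulr0 powR0// gt_eqF.
by rewrite !mulr1 haar_scale_powR// gt_eqF.
Qed.

Lemma measurable_chi n k : measurable_fun setT (chi n k).
Proof. by apply/measurable_indic; exact: measurable_itv. Qed.

Lemma measurable_haar p j : measurable_fun setT (haar p j).
Proof.
case: j => [Q|].
  rewrite (_ : haar p _ = (fun t => haar_scale p (tag Q) *
    (chi (tag Q).+1 (tagged Q).*2.+1 t - chi (tag Q).+1 (tagged Q).*2 t))); last first.
    by apply/funext => t; rewrite haar_SomeE.
  by apply: measurable_funM => //; apply: measurable_funB; exact: measurable_chi.
rewrite (_ : haar p _ = chi 0 0); first exact: measurable_chi.
by apply/funext => t; rewrite haar_NoneE.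
Qed.

End DyadicIndicators.

(** * Integrals and biorthogonality *)
Section Orthogonality.
Context (R : realType).
Implicit Types (p q t : R) (n m k l : nat) (i j : haar_index).

Local Notation mu := (@unit_interval_measure R).

Lemma unit_interval_measureT : mu setT = 1%E.
Proof.
rewrite /unit_interval_measure /mrestr setTI.
by have := lebesgue_measure_itv `[(0:R), 1]; rewrite /= lte_fin ltr01 oppr0 adde0.
Qed.

Lemma position_lt j : (position j < 2 ^ level j)%N.
Proof. by case: j => [[n k]|] //=. Qed.

Lemma integral_chi n k : (k < 2 ^ n)%N ->
  (\int[mu]_t (chi n k t : R)%:E = (2 ^- n)%:E)%E.
Proof.
move=> kn; rewrite /chi integral_indic//; last exact: measurable_itv.
rewrite setIT.
change (lebesgue_measure (dyadic_itv n k `&` `[(0 : R), 1]) = (2 ^- n)%:E).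
have e0 : (0 : R) < 2 ^+ n by rewrite exprn_gt0.
rewrite (_ : _ `&` _ = dyadic_itv n k); last first.
  apply/setIidl => t /mem_set; rewrite mem_dyadic_itv => /andP[kt tk].
  apply/set_mem; rewrite mem_setE in_itv/= -(pmulr_lge0 t e0).
  rewrite (le_trans _ kt)//= -(ler_pM2r e0) mul1r (le_trans (ltW tk))//.
  by rewrite -natrX ler_nat.
rewrite /dyadic_itv.
have := lebesgue_measure_itv `[k%:R / 2 ^+ n, k.+1%:R / 2 ^+ n[ => /= ->.
rewrite lte_fin ltr_pM2r ?invr_gt0// ltr_nat ltnSn -EFinB -mulrBl -natr1.
by rewrite addrAC subrr add0r mul1r.
Qed.

Lemma bounded_integrable (f : R -> R) (C : R) : measurable_fun setT f ->
  (forall t, `|f t| <= C) -> mu.-integrable setT (EFin \o f).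
Proof.
move=> mf fC; apply: measurable_bounded_integrable => //.
  by change (mu setT < +oo)%E; rewrite unit_interval_measureT ltry.
exists C; split; first exact: num_real.
by move=> x Cx t _; apply: le_trans (fC t) (ltW Cx).
Qed.

Lemma chi_le1 n k t : chi n k t <= 1.
Proof. by rewrite /chi indicE lern1 leq_b1. Qed.

Lemma normr_haar_le p j t : `|haar p j t| <= haar_scale p (level j).
Proof. by rewrite normr_haar ler_piMr ?chi_le1// ltW// haar_scale_gt0. Qed.

Lemma integrable_chi n k : mu.-integrable setT (EFin \o (chi n k : R -> R)).
Proof.
apply: (@bounded_integrable _ 1); first exact: measurable_chi.
by move=> t; rewrite ger0_norm ?chi_ge0// chi_le1.
Qed.

Lemma integrable_haar p j : mu.-integrable setT (EFin \o haar p j).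
Proof.
by apply: bounded_integrable (@normr_haar_le p j); exact: measurable_haar.
Qed.

Lemma Rintegral_chi n k : (k < 2 ^ n)%N -> \int[mu]_t (chi n k t : R) = 2 ^- n.
Proof. by move=> kn; rewrite /Rintegral integral_chi. Qed.

Lemma Rintegral_haar_Some p (Q : dyadic) : \int[mu]_t haar p (Some Q) t = 0.
Proof.
under eq_Rintegral do rewrite haar_SomeE.
have h := ltn_ord (tagged Q).
rewrite RintegralZl//; last first.
  exact: (integrableB measurableT (integrable_chi _ _) (integrable_chi _ _)).
rewrite RintegralB//; [|exact: integrable_chi..].
rewrite !Rintegral_chi ?subrr ?mulr0//.
  by rewrite expnS mul2n ltn_double.
by rewrite expnS mul2n ltn_Sdouble.
Qed.

Lemma integral_normr_haar_powR p j : 0 < p ->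
  (\int[mu]_t (`|haar p j t| `^ p)%:E = 1)%E.
Proof.
move=> p0; under eq_integral do rewrite normr_haar_powR// EFinM.
rewrite integralZl//; last exact: integrable_chi.
by rewrite integral_chi ?position_lt// -EFinM divff// gt_eqF// exprn_gt0.
Qed.

Lemma haar_chi p j t :
  chi (level j) (position j) t * haar p j t = haar p j t.
Proof.
have := normr_haar p j t; rewrite /chi indicE; case: (t \in _).
  by rewrite mul1r.
by rewrite mulr0 => /eqP; rewrite normr_eq0 => /eqP ->; rewrite mulr0.
Qed.

Lemma dyadic_eq (P Q : dyadic) : level (Some P) = level (Some Q) ->
  position (Some P) = position (Some Q) -> P = Q.
Proof.
case: P Q => [n k] [m l] /= nm; move: k; rewrite nm => k e.
by congr existT; apply: val_inj.
Qed.

Lemma haarM_same_level p q (P Q : dyadic) t : P != Q -> tag P = tag Q ->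
  haar p (Some P) t * haar q (Some Q) t = 0.
Proof.
move=> PQ lPQ; rewrite -(haar_chi p (Some P)) -(haar_chi q (Some Q)) mulrACA.
rewrite (lPQ : level (Some P) = level (Some Q)).
rewrite (chiM _ _ _ (leqnn _)) subnn expn0 divn1.
case: eqP => [e|]; last by rewrite !mul0r.
by case/eqP: PQ; exact: dyadic_eq lPQ e.
Qed.

(** A Haar function is constant on every dyadic interval of a strictly higher
    level, so that its product with a finer Haar function is a multiple of
    the latter, whose mean is zero. *)
Lemma haar_finer p q i (Q : dyadic) : i != Some Q ->
    (if i is Some P then (tag P < tag Q)%N else true) ->
  \int[mu]_t (haar p i t * haar q (Some Q) t) = 0.
Proof.
move=> iQ iltQ.
suff [c hc] : exists c, forall t,
    haar p i t * haar q (Some Q) t = c * haar q (Some Q) t.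
  under eq_Rintegral do rewrite hc.
  rewrite RintegralZl//; last exact: integrable_haar.
  by rewrite Rintegral_haar_Some mulr0.
have chiH n k t : (n <= tag Q)%N -> chi n k t * haar q (Some Q) t =
    (k == tagged Q %/ 2 ^ (tag Q - n))%N%:R * haar q (Some Q) t.
  by move=> nQ; rewrite -(haar_chi q (Some Q)) !mulrA chiM.
case: i iltQ {iQ} => [P PQ|_].
- eexists => t; rewrite (haar_SomeE p P) -mulrA mulrBl !chiH// -mulrBl mulrA.
  reflexivity.
- eexists => t; rewrite haar_NoneE chiH//.
Qed.

(** Functions of different levels are covered by [haar_finer], distinct
    functions of the same level have disjoint supports, and on the diagonal the
    two normalizations multiply to the reciprocal of the length. *)
Lemma Rintegral_haarM p q i j : 1 < p -> p^-1 + q^-1 = 1 ->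
  \int[mu]_t (haar p i t * haar q j t) = (i == j)%:R.
Proof.
move=> p1 pq; have [<-|ij] := eqVneq i j.
  transitivity (\int[mu]_t (2 ^+ level i * chi (level i) (position i) t)).
    apply: eq_Rintegral => t _.
    have : 0 <= haar p i t * haar q i t.
      case: i => [Q|]; last by rewrite !haar_NoneE mulr_ge0 ?chi_ge0.
      rewrite !haar_SomeE mulrACA -expr2 mulr_ge0 ?sqr_ge0//.
      by rewrite mulr_ge0// ltW// haar_scale_gt0.
    move=> /ger0_norm <-; rewrite normrM !normr_haar mulrACA haar_scale_conj//.
    by rewrite chiM// subnn expn0 divn1 eqxx mul1r.
  rewrite RintegralZl//; last exact: integrable_chi.
  by rewrite Rintegral_chi ?position_lt// divff// gt_eqF// exprn_gt0.
have sym : \int[mu]_t (haar p i t * haar q j t)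
         = \int[mu]_t (haar q j t * haar p i t).
  by apply: eq_Rintegral => t _; rewrite mulrC.
case: j ij sym => [Q|]; last first.
  case: i => [P|//] ij ->.
  exact: haar_finer.
case: i => [P|] ij sym; last exact: haar_finer.
have [PQ|QP|PQ] := ltngtP (tag P) (tag Q).
- exact: haar_finer.
- by rewrite sym; apply: haar_finer; [rewrite eq_sym|].
transitivity (\int[mu]_(t in setT) (0 : R)); last by rewrite /Rintegral integral0.
by apply: eq_Rintegral => t _; apply: haarM_same_level.
Qed.

End Orthogonality.

(** * Upper estimate for sums of Haar functions *)
Section PointwiseEstimate.
Context (R : realType).
Implicit Types (p q t : R) (n m k l : nat) (i j : haar_index) (A : seq haar_index).

Lemma ln2_ge_half : 2^-1 <= ln (2 : R).
Proof.
have : ln (1 + (- 2^-1)) <= - 2^-1 :> R by apply: le_ln1Dx; lra.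
rewrite (_ : 1 + - 2^-1 = 2^-1 :> R); last by lra.
by rewrite lnV ?posrE// lerN2.
Qed.

Lemma ln2_le1 : ln (2 : R) <= 1.
Proof.
have : ln (1 + 1) <= 1 :> R by apply: le_ln1Dx; lra.
by rewrite -(natrD _ 1 1).
Qed.

Lemma powR_expR p : 2 `^ p = expR (p * ln 2).
Proof. by rewrite /powR gt_eqF. Qed.

Lemma haar_scaleS p n : haar_scale p n.+1 = 2 `^ p^-1 * haar_scale p n.
Proof. by rewrite !haar_scale_exp exprS. Qed.

(** The ratio [2 `^ p^-1] exceeds 1 by at least [ln 2 / p], so a geometric
    sum is at most a multiple of [p] times its last term. *)
Lemma sum_haar_scale_le p n : 1 <= p ->
  \sum_(0 <= k < n.+1) haar_scale p k <= 4 * p * haar_scale p n.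
Proof.
move=> p1; have p0 : 0 < p by lra.
have ratio : 1 + (2 * p)^-1 <= 2 `^ p^-1.
  rewrite powR_expR; apply: le_trans (expR_ge1Dx _).
  by rewrite lerD2l invfM mulrC ler_wpM2l ?ln2_ge_half// invr_ge0 ltW.
elim: n => [|n IH].
  by rewrite big_nat1 /haar_scale expr0 powR1; lra.
rewrite big_nat_recr//= haar_scaleS.
have := haar_scale_gt0 p n; set s := haar_scale p n => s0.
apply: le_trans (lerD IH (lexx _)) _; rewrite -/s.
have : 4 * p + 2 `^ p^-1 <= 4 * p * 2 `^ p^-1.
  have pV : p * (2 * p)^-1 = 2^-1 by field; rewrite gt_eqF.
  have := ler_wpM2l (_ : 0 <= 4 * p - 1) ratio.
  have pV1 : (2 * p)^-1 <= 2^-1 by rewrite lef_pV2 ?posrE; lra.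
  by move=> /(_ ltac:(lra)); nra.
by move=> h; have := ler_wpM2r (ltW s0) h; lra.
Qed.

Lemma sum_uniq_subset_le (I : eqType) (F : I -> R) (s s' : seq I) :
  uniq s -> {subset s <= s'} -> (forall x, 0 <= F x) ->
  \sum_(x <- s) F x <= \sum_(x <- s') F x.
Proof.
move=> + + F0; elim: s s' => [|x s IH] s' /=.
  by move=> _ _; rewrite big_nil sumr_ge0.
move=> /andP[xs us] ss'; have xs' : x \in s' by apply: ss'; rewrite mem_head.
rewrite (perm_big _ (perm_to_rem xs')) !big_cons lerD2l IH// => y ys.
apply: rem_mem; first by apply: contraNneq xs => <-.
by apply: ss'; rewrite inE ys orbT.
Qed.

Lemma exists_argmax_level A : A != [::] ->
  exists2 j, j \in A & forall i, i \in A -> (level i <= level j)%N.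
Proof.
elim: A => // j [|j' A] IH _.
  by exists j => [|i]; rewrite inE// => /eqP ->.
have [//|i iA imax] := IH.
have [ij|ji] := leqP (level i) (level j).
  exists j; first exact: mem_head.
  by move=> k; rewrite inE => /predU1P[-> //|/imax ki]; apply: leq_trans ij.
exists i; first by rewrite inE iA orbT.
by move=> k; rewrite inE => /predU1P[->|/imax //]; exact: ltnW.
Qed.

(** Only one dyadic interval of each level contains [t], so among the Haar
    functions that do not vanish at [t] at most two have a given level (two only
    at level 0, because of the constant function).  Their sum is dominated by
    twice a geometric sum, hence by its largest term, and the [p]-th power of
    that term is one of the terms on the right. *)
Lemma sum_normr_haar_le p A t : 1 <= p -> uniq A ->
  (\sum_(j <- A) `|haar p j t|) `^ p <=
  (8 * p) `^ p * \sum_(j <- A) `|haar p j t| `^ p.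
Proof.
move=> p1 uA; have p0 : 0 < p by lra.
pose B := [seq j <- A | t \in (dyadic_itv (level j) (position j) : set R)].
have hB j : j \in B -> `|haar p j t| = haar_scale p (level j).
  by rewrite mem_filter normr_haar /chi indicE => /andP[-> _]; rewrite mulr1.
have hAB : \sum_(j <- A) `|haar p j t| = \sum_(j <- B) `|haar p j t|.
  rewrite big_filter [RHS]big_mkcond; apply: eq_bigr => j _.
  case: ifPn => // /negbTE tj.
  by rewrite normr_haar /chi indicE tj mulr0.
have [B0|Bn0] := eqVneq B [::].
  by rewrite hAB B0 big_nil powR0 ?gt_eqF// mulr_ge0 ?powR_ge0// sumr_ge0.
have [j0 j0B jmax] := exists_argmax_level Bn0.
have j0A : j0 \in A by move: j0B; rewrite mem_filter => /andP[].
have -> : (8 * p) `^ p * \sum_(j <- A) `|haar p j t| `^ p =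
   (8 * p) `^ p * `|haar p j0 t| `^ p +
   (8 * p) `^ p * \sum_(j <- rem j0 A) `|haar p j t| `^ p.
  by rewrite (perm_big _ (perm_to_rem j0A)) big_cons mulrDr.
rewrite -[leLHS]addr0 lerD//; last first.
  by rewrite mulr_ge0 ?powR_ge0// sumr_ge0// => j _; exact: powR_ge0.
rewrite -powRM//; last by rewrite mulr_ge0// ltW.
apply: ge0_ler_powR; rewrite ?nnegrE ?(ltW p0) ?sumr_ge0//.
  by rewrite !mulr_ge0// ltW.
rewrite hAB (hB _ j0B) (eq_big_seq _ hB).
(* The level alone does not separate the constant function from the Haar
   function of [0, 1), both of level 0; hence the boolean. *)
pose f j := (isSome j, level j).
have -> : \sum_(j <- B) haar_scale p (level j) =
    \sum_(x <- map f B) haar_scale p x.2 by rewrite big_map.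
pose s := [seq (b, k) | b <- [:: true; false], k <- index_iota 0 (level j0).+1].
apply: (@le_trans _ _ (\sum_(x <- s) haar_scale p x.2)).
  apply: sum_uniq_subset_le; last by move=> x; rewrite ltW// haar_scale_gt0.
  - rewrite map_inj_in_uniq ?filter_uniq// => i j.
    rewrite !mem_filter => /andP[ti _] /andP[tj _] [ij lij].
    case: i j ti tj ij lij => [P|] [Q|]//= ti tj _ lij; congr Some.
    apply: dyadic_eq => //; move: ti.
    have d0 : (tag Q - tag P = 0)%N by rewrite lij subnn.
    rewrite (dyadic_itv_nested _ (eq_leq lij) tj) d0 expn0 divn1.
    by move=> /eqP.
  - move=> x /mapP[j jB ->]; apply/allpairsP; exists (f j) => /=.
    by rewrite mem_index_iota ltnS jmax//; split=> //; case: j {jB}.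
have sum_bool (G : bool -> R) :
    \sum_(b <- [:: true; false]) G b = G true + G false.
  by rewrite !big_cons big_nil addr0.
rewrite /s big_allpairs_dep sum_bool.
have : 4 * p * haar_scale p (level j0) + 4 * p * haar_scale p (level j0) =
  8 * p * haar_scale p (level j0) by ring.
by move=> <-; apply: lerD; exact: sum_haar_scale_le.
Qed.

Local Notation mu := (@unit_interval_measure R).

Local Notation "'N_ p [ f ]" := (Lnorm mu p%:E (EFin \o f)) : ereal_scope.

Lemma measurable_normr_powR (f : R -> R) p : measurable_fun setT f ->
  measurable_fun setT (fun t => (`|f t| `^ p)%:E).
Proof.
move=> mf; apply/measurable_EFinP.
apply: (@measurableT_comp _ _ _ _ _ _ (@powR R ^~ p)) => //.
exact: measurableT_comp.
Qed.

Lemma Lnorm_realE (f : R -> R) p :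
  ('N_p[f] = (\int[mu]_t (`|f t| `^ p)%:E) `^ p^-1)%E.
Proof. by rewrite unlock. Qed.

Lemma ge0_le_poweR (x y : \bar R) p : 0 <= p -> (0 <= x)%E -> (x <= y)%E ->
  (x `^ p <= y `^ p)%E.
Proof.
move=> p0 x0 xy; apply: gt0_ler_poweR => //; rewrite in_itv/= leey andbT//.
exact: le_trans xy.
Qed.

Lemma le_Lnorm (f g : R -> R) p : 0 <= p -> measurable_fun setT f ->
  measurable_fun setT g -> (forall t, `|f t| <= `|g t|) -> ('N_p[f] <= 'N_p[g])%E.
Proof.
move=> p0 mf mg fg; rewrite !Lnorm_realE.
apply: ge0_le_poweR; first by rewrite invr_ge0.
  by apply: integral_ge0 => t _; rewrite lee_fin; exact: powR_ge0.
apply: ge0_le_integral => //; try exact: measurable_normr_powR.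
- by move=> t _; rewrite lee_fin ge0_ler_powR ?nnegrE.
Qed.

Lemma integral_sum_normr_haar_powR p A : 0 < p ->
  (\int[mu]_t (\sum_(j <- A) `|haar p j t| `^ p)%:E = (size A)%:R%:E)%E.
Proof.
move=> p0; under eq_integral do rewrite -sumEFin.
rewrite ge0_integral_sum//.
- under eq_bigr do rewrite integral_normr_haar_powR//.
  by rewrite sumEFin big_const_seq count_predT iter_addr addr0.
- by move=> j; apply: measurable_normr_powR; exact: measurable_haar.
Qed.

Definition sum_normr_haar p A t : R := \sum_(j <- A) `|haar p j t|.

Lemma measurable_sum_normr_haar p A : measurable_fun setT (sum_normr_haar p A).
Proof.
apply: measurable_sum => j; apply: measurableT_comp => //.
exact: measurable_haar.
Qed.

Lemma Lnorm_sum_normr_haar_le p A : 1 <= p -> uniq A ->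
  ('N_p[sum_normr_haar p A] <= (8 * p * (size A)%:R `^ p^-1)%:E)%E.
Proof.
move=> p1 uA; have p0 : 0 < p by lra.
rewrite Lnorm_realE.
apply: (@le_trans _ _ (((8 * p) `^ p * (size A)%:R)%:E `^ p^-1)%E); last first.
  by rewrite poweR_EFin lee_fin powRM// ?powR_ge0// -powRrM divff ?gt_eqF//
     powRr1// mulr_ge0// ltW.
apply: ge0_le_poweR; first by rewrite invr_ge0 ltW.
  by apply: integral_ge0 => t _; rewrite lee_fin; exact: powR_ge0.
have mS : measurable_fun setT (fun t => (\sum_(j <- A) `|haar p j t| `^ p)%:E).
  apply/measurable_EFinP; apply: measurable_sum => j.
  by apply/measurable_EFinP; apply: measurable_normr_powR; exact: measurable_haar.
rewrite EFinM -(integral_sum_normr_haar_powR A p0) -ge0_integralZl//; first last.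
- by rewrite lee_fin; exact: powR_ge0.
- by move=> t _; rewrite lee_fin sumr_ge0// => j _; rewrite powR_ge0.
apply: ge0_le_integral => //.
- by apply: measurable_normr_powR; exact: measurable_sum_normr_haar.
- exact: emeasurable_funM.
- move=> t _; rewrite -EFinM lee_fin ger0_norm ?sumr_ge0//.
  exact: sum_normr_haar_le.
Qed.

End PointwiseEstimate.

(** * Pairing with Haar functions, real and complex scalars *)
Section RealPairing.
Context (R : realType).
Implicit Types (p q t : R) (i j : haar_index) (A B : seq haar_index).

Local Notation mu := (@unit_interval_measure R).
Local Notation "'N_ p [ f ]" := (Lnorm mu p%:E (EFin \o f)) : ereal_scope.

Lemma conj_exponentP p : 1 < p -> p^-1 + (conj_exponent p)^-1 = 1.
Proof. by move=> p1; rewrite /conj_exponent; field; lra. Qed.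

Lemma conj_exponent_gt1 p : 1 < p -> 1 < conj_exponent p.
Proof.
by move=> p1; rewrite /conj_exponent ltr_pdivlMr ?subr_gt0//; lra.
Qed.

Lemma Lnorm_haar p j : 0 < p -> ('N_p[haar p j] = 1)%E.
Proof.
by move=> p0; rewrite Lnorm_realE integral_normr_haar_powR// poweR_EFin powR1.
Qed.

Lemma integrable_mul_haar (g : R -> R) p q j : 1 < p -> 1 < q ->
    p^-1 + q^-1 = 1 -> measurable_fun setT g -> ('N_p[g] < +oo)%E ->
  mu.-integrable setT (EFin \o (fun t => g t * haar q j t)).
Proof.
move=> p1 q1 pq mg gfin; apply/integrableP; split.
  by apply/measurable_EFinP; apply: measurable_funM => //; exact: measurable_haar.
have p0 : 0 < p by lra.
have q0 : 0 < q by lra.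
have := hoelder mu mg (measurable_haar q j) p0 q0 pq.
rewrite Lnorm_haar// mule1 Lnorm1 => h; exact: le_lt_trans gfin.
Qed.

(** The combination of coefficients is a single integral of [g] against a
    function dominated by the sum of the [|haar q j|], to which Hoelder
    applies. *)
Lemma sum_coef_haar_pairing_le (g : R -> R) p q (a : haar_index -> R) B :
    1 < p -> 1 < q -> p^-1 + q^-1 = 1 -> measurable_fun setT g ->
    ('N_p[g] < +oo)%E -> (forall j, `|a j| <= 1) -> uniq B ->
  (`|\sum_(j <- B) a j * \int[mu]_t (g t * haar q j t)|%:E <=
   'N_p[g] * (8 * q * (size B)%:R `^ q^-1)%:E)%E.
Proof.
move=> p1 q1 pq mg gfin a1 uB.
have [p0 q0] : 0 < p /\ 0 < q by split; lra.
pose H t := \sum_(j <- B) a j * haar q j t.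
have mH : measurable_fun setT H.
  apply: measurable_sum => j; apply: measurable_funM => //.
  exact: measurable_haar.
have HS t : `|H t| <= `|sum_normr_haar q B t|.
  rewrite [leRHS]ger0_norm ?sumr_ge0//; apply: le_trans (ler_norm_sum _ _ _) _.
  by apply: ler_sum => j _; rewrite normrM ler_piMl.
have ig j := integrable_mul_haar j p1 q1 pq mg gfin.
have iH : mu.-integrable setT (EFin \o (fun t => g t * H t)).
  rewrite (_ : EFin \o _ =
      (fun t => \sum_(j <- B) (a j)%:E * (g t * haar q j t)%:E)%E); last first.
    apply/funext => t /=; rewrite /H mulr_sumr -sumEFin.
    by apply: eq_bigr => j _; rewrite -EFinM mulrCA.
  apply: integrable_sum => // j _; apply: integrableZl => //.
  exact: ig.
have -> : \sum_(j <- B) a j * \int[mu]_t (g t * haar q j t) =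
    \int[mu]_t (g t * H t).
  rewrite /Rintegral; transitivity
    (fine (\int[mu]_t (\sum_(j <- B) (a j)%:E * (g t * haar q j t)%:E)%E)%E);
    last first.
    congr fine; apply: eq_integral => t _; rewrite /H mulr_sumr -sumEFin.
    by apply: eq_bigr => j _; rewrite -EFinM mulrCA.
  rewrite integral_sum//; last first.
    by move=> j; apply: integrableZl => //; exact: ig.
  have fin j : (\int[mu]_t (g t * haar q j t)%:E)%E \is a fin_num.
    by apply: integrable_fin_num => //; exact: ig.
  rewrite (eq_bigr (fun j => (a j * fine (\int[mu]_t (g t * haar q j t)%:E)%E)%:E)).
    by rewrite sumEFin.
  move=> j _; rewrite integralZl//; last exact: ig.
  by rewrite EFinM fineK.
apply: (@le_trans _ _ ('N_p[g] * 'N_q[H])%E); last first.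
  apply: lee_wpmul2l; first exact: Lnorm_ge0.
  apply: le_trans (Lnorm_sum_normr_haar_le (ltW q1) uB).
  by apply: le_Lnorm => //; [lra|exact: measurable_sum_normr_haar].
apply: le_trans (hoelder mu mg mH p0 q0 pq); rewrite Lnorm1.
apply: le_trans (le_abse_integral mu measurableT (measurable_int _ iH)).
rewrite -(fineK (integrable_fin_num _ iH))//.
Qed.

Lemma Rintegral_haar_sumM p q (c : haar_index -> R) A j : 1 < p -> 1 < q ->
    p^-1 + q^-1 = 1 -> uniq A -> j \in A ->
  \int[mu]_t ((\sum_(i <- A) c i * haar p i t) * haar q j t) = c j.
Proof.
move=> p1 q1 pq uA jA.
have ih i : mu.-integrable setT (EFin \o (fun t => haar p i t * haar q j t)).
  apply: (@bounded_integrable R _ (haar_scale p (level i) * haar_scale q (level j))).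
    by apply: measurable_funM; exact: measurable_haar.
  by move=> t; rewrite normrM ler_pM// normr_haar_le.
transitivity (fine (\int[mu]_t
    (\sum_(i <- A) (c i)%:E * (haar p i t * haar q j t)%:E)%E)%E).
  congr fine; apply: eq_integral => t _; rewrite mulr_suml -sumEFin.
  by apply: eq_bigr => i _; rewrite -EFinM mulrA.
rewrite integral_sum//; last by move=> i; apply: integrableZl => //; exact: ih.
rewrite (eq_bigr (fun i => (c i * (i == j)%:R)%:E)); last first.
  move=> i _; rewrite integralZl//; last exact: ih.
  rewrite [RHS]EFinM -(Rintegral_haarM i j p1 pq) fineK//.
  by apply: integrable_fin_num => //; exact: ih.
rewrite sumEFin (bigD1_seq j)//= eqxx mulr1 big1 ?addr0// => i /negbTE ->.
by rewrite mulr0.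
Qed.

End RealPairing.

Section Scalars.
Context (R : realType) (F : scalars).
Implicit Types (p q t : R) (i j : haar_index) (z w : scalar_field R F).

Local Notation mu := (@unit_interval_measure R).

(** The real and imaginary parts reduce all estimates to real functions, for
    both scalar fields at once; a real scalar has imaginary part 0. *)
Definition re_part : scalar_field R F -> R :=
  match F return scalar_field R F -> R with
  | RealScalars => fun z : R => z
  | ComplexScalars => fun z : R[i] => complex.Re z
  end.

Definition im_part : scalar_field R F -> R :=
  match F return scalar_field R F -> R with
  | RealScalars => fun=> 0
  | ComplexScalars => fun z : R[i] => complex.Im z
  end.

Lemma re_partD z w : re_part (z + w) = re_part z + re_part w.
Proof. by rewrite /re_part; case: F z w => //= -[a b] [c d]. Qed.

Lemma im_partD z w : im_part (z + w) = im_part z + im_part w.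
Proof.
by rewrite /im_part; case: F z w => [/= _ _|[a b] [c d]]; rewrite ?addr0.
Qed.

Lemma re_part0 : re_part 0 = 0.
Proof. by rewrite /re_part; case: F. Qed.

Lemma im_part0 : im_part 0 = 0.
Proof. by rewrite /im_part; case: F. Qed.

Lemma re_part_sum (I : Type) (s : seq I) (f : I -> scalar_field R F) :
  re_part (\sum_(i <- s) f i) = \sum_(i <- s) re_part (f i).
Proof. by apply: big_morph; [exact: re_partD|exact: re_part0]. Qed.

Lemma im_part_sum (I : Type) (s : seq I) (f : I -> scalar_field R F) :
  im_part (\sum_(i <- s) f i) = \sum_(i <- s) im_part (f i).
Proof. by apply: big_morph; [exact: im_partD|exact: im_part0]. Qed.

Lemma re_partM_real z (a : R) : re_part (z * of_real F a) = re_part z * a.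
Proof.
rewrite /re_part /of_real; case: F z => [//|[b c]] /=.
by rewrite mulr0 subr0.
Qed.

Lemma im_partM_real z (a : R) : im_part (z * of_real F a) = im_part z * a.
Proof.
rewrite /im_part /of_real; case: F z => [|[b c]] /=; first by rewrite mul0r.
by rewrite mulr0 add0r.
Qed.

Lemma modulus_sqr z : modulus z ^+ 2 = re_part z ^+ 2 + im_part z ^+ 2.
Proof.
rewrite /modulus /re_part /im_part; case: F z => [z|[a b]] /=.
  by rewrite expr0n addr0 real_normK// num_real.
by rewrite sqr_sqrtr// addr_ge0// sqr_ge0.
Qed.

Lemma modulus_ge0 z : 0 <= modulus z.
Proof. by rewrite /modulus; case: F z => [z|[a b]] /=; rewrite ?sqrtr_ge0. Qed.

Lemma modulusE z : modulus z = Num.sqrt (re_part z ^+ 2 + im_part z ^+ 2).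
Proof. by rewrite -modulus_sqr sqrtr_sqr ger0_norm// modulus_ge0. Qed.

Lemma modulusM z w : modulus (z * w) = modulus z * modulus w.
Proof.
rewrite /modulus; case: F z w => [z w|z w]; first exact: normrM.
rewrite normrM; case: z => a b; case: w => c d /=.
by rewrite mul0r subr0.
Qed.

Lemma modulusD z w : modulus (z + w) <= modulus z + modulus w.
Proof.
rewrite /modulus; case: F z w => [z w|z w]; first exact: ler_normD.
by have := ler_normD z w; rewrite lecE => /andP[].
Qed.

Lemma modulus0 : modulus (0 : scalar_field R F) = 0.
Proof. by rewrite modulusE re_part0 im_part0 expr0n addr0 sqrtr0. Qed.

Lemma modulus_of_real (a : R) : modulus (of_real F a) = `|a|.
Proof.
rewrite modulusE -sqrtr_sqr; congr Num.sqrt.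
by rewrite /re_part /im_part /of_real; case: F => /=; rewrite expr0n addr0.
Qed.

Lemma modulus_sum_le (I : Type) (s : seq I) (f : I -> scalar_field R F) :
  modulus (\sum_(i <- s) f i) <= \sum_(i <- s) modulus (f i).
Proof.
elim/big_rec2: _ => [|k a z _ h]; first by rewrite modulus0.
by apply: le_trans (modulusD _ _) _; rewrite lerD2l.
Qed.

Lemma normr_re_part_le z : `|re_part z| <= modulus z.
Proof. by rewrite modulusE -sqrtr_sqr ler_sqrt ?lerDl ?addr_ge0 ?sqr_ge0. Qed.

Lemma normr_im_part_le z : `|im_part z| <= modulus z.
Proof. by rewrite modulusE -sqrtr_sqr ler_sqrt ?lerDr ?addr_ge0 ?sqr_ge0. Qed.

Lemma modulus_le z : modulus z <= `|re_part z| + `|im_part z|.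
Proof.
rewrite modulusE -[leRHS]ger0_norm ?addr_ge0// -sqrtr_sqr ler_sqrt ?sqr_ge0//.
rewrite sqrrD !real_normK ?num_real// addrAC lerDl.
by rewrite mulrn_wge0// mulr_ge0.
Qed.

Lemma scalar_measurableP (f : R -> scalar_field R F) :
  @scalar_measurable R _ (measurableTypeR R) F f <->
  measurable_fun setT (re_part \o f) /\ measurable_fun setT (im_part \o f).
Proof.
rewrite /scalar_measurable /re_part /im_part; case: F f => f //.
by split=> [mf|[]//]; split => //; exact: measurable_cst.
Qed.

Lemma measurable_modulus (f : R -> scalar_field R F) :
  @scalar_measurable R _ (measurableTypeR R) F f ->
  measurable_fun setT (fun t => modulus (f t)).
Proof.
move=> /scalar_measurableP[mre mim].
rewrite (_ : (fun t => _) = fun t =>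
    ((re_part (f t)) ^+ 2 + (im_part (f t)) ^+ 2) `^ 2^-1); last first.
  by apply/funext => t; rewrite powR12_sqrt ?addr_ge0 ?sqr_ge0// -modulusE.
apply: (@measurableT_comp _ _ _ _ _ _ (@powR R ^~ 2^-1)) => //.
by apply: measurable_funD; exact: measurable_funX.
Qed.

Lemma re_part_scalar_integral (f : R -> scalar_field R F) :
  re_part (scalar_integral mu f) = \int[mu]_t re_part (f t).
Proof. by rewrite /re_part /scalar_integral; case: F f. Qed.

Lemma im_part_scalar_integral (f : R -> scalar_field R F) :
  im_part (scalar_integral mu f) = \int[mu]_t im_part (f t).
Proof.
rewrite /im_part /scalar_integral; case: F f => //= f.
by rewrite /Rintegral integral0.
Qed.

End Scalars.

(** * Norms of unimodular sums and dual norms *)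
Section HaarSystem.
Context (R : realType) (F : scalars).
Implicit Types (p q t : R) (i j : haar_index) (A B : seq haar_index)
  (eps delta : haar_index -> scalar_field R F) (f : R -> (scalar_field R F)^o).

Local Notation mu := (@unit_interval_measure R).
Local Notation "'N_ p [ f ]" := (Lnorm mu p%:E (EFin \o f)) : ereal_scope.

Definition haar_sum p A eps : R -> (scalar_field R F)^o :=
  \sum_(j <- A) eps j *: haar_system F p j.

Lemma haar_sumE p A eps t :
  haar_sum p A eps t = \sum_(j <- A) eps j * of_real F (haar p j t).
Proof.
rewrite /haar_sum; elim: A => [|j A IH]; first by rewrite !big_nil.
by rewrite !big_cons -IH.
Qed.

Lemma re_part_haar_sum p A eps t : re_part (haar_sum p A eps t) =
  \sum_(j <- A) re_part (eps j) * haar p j t.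
Proof.
rewrite haar_sumE re_part_sum; apply: eq_bigr => j _.
exact: re_partM_real.
Qed.

Lemma im_part_haar_sum p A eps t : im_part (haar_sum p A eps t) =
  \sum_(j <- A) im_part (eps j) * haar p j t.
Proof.
rewrite haar_sumE im_part_sum; apply: eq_bigr => j _.
exact: im_partM_real.
Qed.

Lemma scalar_measurable_haar_sum p A eps :
  @scalar_measurable R _ (measurableTypeR R) F (haar_sum p A eps).
Proof.
apply/scalar_measurableP; split.
  rewrite (_ : _ \o _ = fun t => \sum_(j <- A) re_part (eps j) * haar p j t).
    apply: measurable_sum => j; apply: measurable_funM => //.
    exact: measurable_haar.
  by apply/funext => t; rewrite /= re_part_haar_sum.
rewrite (_ : _ \o _ = fun t => \sum_(j <- A) im_part (eps j) * haar p j t).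
  apply: measurable_sum => j; apply: measurable_funM => //.
  exact: measurable_haar.
by apply/funext => t; rewrite /= im_part_haar_sum.
Qed.

Lemma unimodular1 : unimodular (fun=> 1 : scalar_field R F) (J := haar_index).
Proof.
move=> j; rewrite -[1](_ : of_real F 1 = 1) ?modulus_of_real ?normr1//.
by rewrite /of_real; case: F.
Qed.

Lemma modulus_haar_sum_le p A eps t : unimodular eps ->
  modulus (haar_sum p A eps t) <= sum_normr_haar p A t.
Proof.
move=> e1; rewrite haar_sumE; apply: le_trans (modulus_sum_le _ _) _.
apply: ler_sum => j _.
by rewrite modulusM e1 mul1r modulus_of_real.
Qed.

Lemma Lp_norm_haar_sum_le p A eps : 1 < p -> uniq A -> unimodular eps ->
  (Lp_norm p (haar_sum p A eps) <= (8 * p * (size A)%:R `^ p^-1)%:E)%E.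
Proof.
move=> p1 uA e1; apply: le_trans (Lnorm_sum_normr_haar_le (ltW p1) uA).
apply: le_Lnorm.
- by lra.
- by apply: measurable_modulus; exact: scalar_measurable_haar_sum.
- exact: measurable_sum_normr_haar.
move=> t; rewrite !ger0_norm ?modulus_ge0 ?sumr_ge0//.
exact: modulus_haar_sum_le.
Qed.

Lemma Lnorm_re_part_le p f : 0 <= p ->
    @scalar_measurable R _ (measurableTypeR R) F f ->
  ('N_p[(fun t => re_part (f t))] <= Lp_norm p f)%E.
Proof.
move=> p0 mf; have [mre mim] := (scalar_measurableP _).1 mf.
apply: le_Lnorm => //; first exact: measurable_modulus.
by move=> t; rewrite [leRHS]ger0_norm ?modulus_ge0// normr_re_part_le.
Qed.

Lemma Lnorm_im_part_le p f : 0 <= p ->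
    @scalar_measurable R _ (measurableTypeR R) F f ->
  ('N_p[(fun t => im_part (f t))] <= Lp_norm p f)%E.
Proof.
move=> p0 mf; have [mre mim] := (scalar_measurableP _).1 mf.
apply: le_Lnorm => //; first exact: measurable_modulus.
by move=> t; rewrite [leRHS]ger0_norm ?modulus_ge0// normr_im_part_le.
Qed.

Lemma re_part_haar_coord p j f : re_part (haar_coord p j f) =
  \int[mu]_t (re_part (f t) * haar (conj_exponent p) j t).
Proof.
rewrite re_part_scalar_integral; apply: eq_Rintegral => t _.
exact: re_partM_real.
Qed.

Lemma im_part_haar_coord p j f : im_part (haar_coord p j f) =
  \int[mu]_t (im_part (f t) * haar (conj_exponent p) j t).
Proof.
rewrite im_part_scalar_integral; apply: eq_Rintegral => t _.
exact: im_partM_real.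
Qed.

Lemma re_part_pairing_le p f (a : haar_index -> R) B : 1 < p -> Lp p f ->
    (forall j, `|a j| <= 1) -> uniq B ->
  (`|\sum_(j <- B) a j * re_part (haar_coord p j f)|%:E <=
   Lp_norm p f * (8 * conj_exponent p * (size B)%:R `^ (conj_exponent p)^-1)%:E)%E.
Proof.
move=> p1 [mf fp] a1 uB; have q1 := conj_exponent_gt1 p1.
have q0 : 0 <= conj_exponent p by lra.
have [mre _] := (scalar_measurableP _).1 mf.
have p0 : 0 <= p by lra.
have le1 := Lnorm_re_part_le p0 mf.
under eq_bigr do rewrite re_part_haar_coord.
apply: le_trans (sum_coef_haar_pairing_le p1 q1 (conj_exponentP p1) mre
  (le_lt_trans le1 fp) a1 uB) _.
by apply: lee_wpmul2r => //; rewrite lee_fin mulr_ge0 ?powR_ge0// mulr_ge0.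
Qed.

Lemma im_part_pairing_le p f (a : haar_index -> R) B : 1 < p -> Lp p f ->
    (forall j, `|a j| <= 1) -> uniq B ->
  (`|\sum_(j <- B) a j * im_part (haar_coord p j f)|%:E <=
   Lp_norm p f * (8 * conj_exponent p * (size B)%:R `^ (conj_exponent p)^-1)%:E)%E.
Proof.
move=> p1 [mf fp] a1 uB; have q1 := conj_exponent_gt1 p1.
have q0 : 0 <= conj_exponent p by lra.
have [_ mim] := (scalar_measurableP _).1 mf.
have p0 : 0 <= p by lra.
have le1 := Lnorm_im_part_le p0 mf.
under eq_bigr do rewrite im_part_haar_coord.
apply: le_trans (sum_coef_haar_pairing_le p1 q1 (conj_exponentP p1) mim
  (le_lt_trans le1 fp) a1 uB) _.
by apply: lee_wpmul2r => //; rewrite lee_fin mulr_ge0 ?powR_ge0// mulr_ge0.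
Qed.

Lemma Lp_haar_sum p A eps : 1 < p -> uniq A -> unimodular eps ->
  Lp p (haar_sum p A eps).
Proof.
move=> p1 uA e1; split; first exact: scalar_measurable_haar_sum.
by apply: le_lt_trans (Lp_norm_haar_sum_le p1 uA e1) (ltry _).
Qed.

Lemma re_part_haar_coord_sum p A eps j : 1 < p -> uniq A -> j \in A ->
  re_part (haar_coord p j (haar_sum p A eps)) = re_part (eps j).
Proof.
move=> p1 uA jA; rewrite re_part_haar_coord.
under eq_Rintegral do rewrite re_part_haar_sum.
exact: Rintegral_haar_sumM p1 (conj_exponent_gt1 p1) (conj_exponentP p1) uA jA.
Qed.

Lemma im_part_haar_coord_sum p A eps j : 1 < p -> uniq A -> j \in A ->
  im_part (haar_coord p j (haar_sum p A eps)) = im_part (eps j).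
Proof.
move=> p1 uA jA; rewrite im_part_haar_coord.
under eq_Rintegral do rewrite im_part_haar_sum.
exact: Rintegral_haar_sumM p1 (conj_exponent_gt1 p1) (conj_exponentP p1) uA jA.
Qed.

Lemma powR_conj_split p (m : nat) : 1 < p ->
  m%:R `^ p^-1 * m%:R `^ (conj_exponent p)^-1 = m%:R :> R.
Proof.
move=> p1; rewrite -powRD conj_exponentP// ?powRr1//.
by rewrite oner_eq0.
Qed.

(** Pairing the real part of the sum with [re_part \o eps] and the imaginary
    part with [im_part \o eps] counts the terms, because the squares of the two
    parts of a unimodular scalar add up to 1.  Hoelder then turns the upper bound
    for the conjugate exponent into a lower bound for [p]. *)
Lemma Lp_norm_haar_sum_ge p A eps : 1 < p -> uniq A -> unimodular eps ->
  (((size A)%:R `^ p^-1)%:E <=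
   (16 * conj_exponent p)%:E * Lp_norm p (haar_sum p A eps))%E.
Proof.
move=> p1 uA e1; have q1 := conj_exponent_gt1 p1.
have q0 : 0 <= conj_exponent p by lra.
have Lf := Lp_haar_sum p1 uA e1.
set N := Lp_norm p _.
have Nfin : N \is a fin_num by rewrite ge0_fin_numE ?Lnorm_ge0//; case: Lf.
have [m0|m0] := posnP (size A).
  rewrite m0 powR0; last by rewrite invr_eq0; lra.
  by rewrite mule_ge0 ?Lnorm_ge0// lee_fin mulr_ge0.
have re1 j : `|re_part (eps j)| <= 1 by rewrite -(e1 j) normr_re_part_le.
have im1 j : `|im_part (eps j)| <= 1 by rewrite -(e1 j) normr_im_part_le.
have := re_part_pairing_le p1 Lf re1 uA.
have := im_part_pairing_le p1 Lf im1 uA.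
rewrite -/N -(fineK Nfin) -!EFinM !lee_fin.
set K := 8 * _ * _ => h1 h2.
have : (size A)%:R <= fine N * K + fine N * K.
  apply: le_trans (lerD (le_trans (ler_norm _) h2) (le_trans (ler_norm _) h1)).
  rewrite -big_split/= (eq_big_seq (fun=> 1)).
    by rewrite big_const_seq count_predT iter_addr addr0.
  move=> j jA; rewrite re_part_haar_coord_sum// im_part_haar_coord_sum//.
  by rewrite -!expr2 -modulus_sqr e1 expr1n.
have r0 : 0 < (size A)%:R `^ (conj_exponent p)^-1 :> R by rewrite powR_gt0// ltr0n.
rewrite -(ler_pM2r r0) powR_conj_split// /K.
set r := _ `^ _; lra.
Qed.

(** Hoelder, applied separately to the real and the imaginary part of the
    functional: this costs a factor 2. *)
Lemma dual_norm_haar_coord_le p B : 1 < p -> uniq B ->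
  (dual_norm (Lp p) (Lp_norm p)
     (fun f => (\sum_(k <- B) @haar_coord R F p k f)%R) <=
   (16 * conj_exponent p * (size B)%:R `^ (conj_exponent p)^-1)%:E)%E.
Proof.
move=> p1 uB; have q1 := conj_exponent_gt1 p1.
have q0 : 0 <= conj_exponent p by lra.
apply: ge_ereal_sup => _ [f [Lf f1]] <-; rewrite lee_fin.
have one1 (j : haar_index) : `|1 : R| <= 1 by rewrite normr1.
have := re_part_pairing_le p1 Lf one1 uB.
have := im_part_pairing_le p1 Lf one1 uB.
set K := 8 * _ * _.
have K0 : 0 <= K by rewrite mulr_ge0 ?powR_ge0// mulr_ge0.
have fK : (Lp_norm p f * K%:E <= K%:E)%E.
  by rewrite -[leRHS]mul1e; apply: lee_wpmul2r.
move=> /le_trans/(_ fK) + /le_trans/(_ fK); rewrite !lee_fin => h1 h2.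
apply: le_trans (modulus_le _) _; rewrite re_part_sum im_part_sum.
move: h1 h2; under eq_bigr do rewrite mul1r.
move=> h1; under eq_bigr do rewrite mul1r.
move=> h2; apply: le_trans (lerD h2 h1) _.
by rewrite [leRHS](_ : _ = K + K)// /K; ring.
Qed.

Lemma Lnorm_scale p (a : R) (g : R -> R) : 0 < p -> 0 <= a ->
  measurable_fun setT g -> ('N_p[(fun t => a * g t)%R] = a%:E * 'N_p[g])%E.
Proof.
move=> p0 a0 mg; rewrite !Lnorm_realE.
under eq_integral do rewrite normrM powRM// EFinM.
rewrite ge0_integralZl//; last exact: measurable_normr_powR.
rewrite poweRM ?lee_fin ?powR_ge0//; last first.
  by apply: integral_ge0 => t _; rewrite lee_fin powR_ge0.
by rewrite poweR_EFin -powRrM divff ?gt_eqF// ger0_norm// powRr1.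
Qed.

(** The normalized sum of the basis vectors over [B] is a competitor in the
    supremum, and biorthogonality evaluates the functional on it. *)
Lemma dual_norm_haar_coord_ge p B : 1 < p -> uniq B -> (0 < size B)%N ->
  (((size B)%:R / fine (Lp_norm p (haar_sum p B (fun=> 1))))%:E <=
   dual_norm (Lp p) (Lp_norm p)
     (fun f => (\sum_(k <- B) @haar_coord R F p k f)%R))%E.
Proof.
move=> p1 uB B0; have q1 := conj_exponent_gt1 p1.
have q0 : 0 <= conj_exponent p by lra.
have [_ Nlty] := Lp_haar_sum p1 uB unimodular1.
have := Lp_norm_haar_sum_ge p1 uB unimodular1.
set N := Lp_norm p _ in Nlty *.
have Nfin : N \is a fin_num by rewrite ge0_fin_numE ?Lnorm_ge0.
rewrite -(fineK Nfin) -EFinM lee_fin /=; set r := fine N => mr.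
have r0 : 0 < r.
  have : 0 < 16 * conj_exponent p * r.
    by apply: lt_le_trans mr; rewrite powR_gt0// ltr0n.
  by rewrite pmulr_rgt0//; lra.
pose f := haar_sum p B (fun=> of_real F r^-1).
have fE t : modulus (f t) = r^-1 * modulus (haar_sum p B (fun=> 1) t).
  rewrite /f !haar_sumE -mulr_sumr modulusM modulus_of_real.
  rewrite ger0_norm ?invr_ge0 ?ltW//; congr (_ * modulus _).
  by apply: eq_bigr => j _; rewrite mul1r.
have Nf : Lp_norm p f = 1%E.
  transitivity ('N_p[(fun t => r^-1 * modulus (haar_sum p B (fun=> 1) t))%R])%E.
    by apply: eq_Lnorm => t; rewrite /= fE.
  rewrite Lnorm_scale ?invr_ge0 ?(ltW r0)//; last 2 first.
  - by lra.
  - by apply: measurable_modulus; exact: scalar_measurable_haar_sum.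
  rewrite -[X in (_ * X)%E](fineK Nfin) -EFinM mulVf// gt_eqF//.
have Lf : Lp p f.
  by split; [exact: scalar_measurable_haar_sum|rewrite Nf ltry].
apply: (@le_trans _ _ (modulus (\sum_(k <- B) haar_coord p k f))%:E); last first.
  by apply: ereal_sup_ubound; exists f => //; split=> //; rewrite Nf.
rewrite lee_fin; apply: le_trans (normr_re_part_le _).
apply: le_trans (ler_norm _); rewrite re_part_sum.
rewrite (eq_big_seq (fun=> r^-1)); last first.
  move=> k kB; rewrite re_part_haar_coord_sum//.
  by rewrite /re_part /of_real; case: F.
by rewrite big_const_seq count_predT iter_addr addr0 mulr_natl.
Qed.

End HaarSystem.


(** * Two extremal families *)
Section Examples.
Context (R : realType).
Implicit Types (p q t : R) (n k : nat) (i j : haar_index) (A : seq haar_index).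

Local Notation mu := (@unit_interval_measure R).
Local Notation "'N_ p [ f ]" := (Lnorm mu p%:E (EFin \o f)) : ereal_scope.

Lemma pred_expn2_lt k : ((2 ^ k).-1 < 2 ^ k)%N.
Proof. by rewrite prednK// expn_gt0. Qed.

(** The interval [[1 - 2 ^- k, 1)]. *)
Definition chain_index k : haar_index :=
  Some (existT (fun n => 'I_(2 ^ n)) k (Ordinal (pred_expn2_lt k))).

Definition chain n : seq haar_index := map chain_index (iota 0 n).

(** The first [n] dyadic intervals of level [n]; there are enough of them since
    [n <= 2 ^ n], and none belongs to [chain n]. *)
Definition level_family n : seq haar_index :=
  [seq Some (existT (fun n => 'I_(2 ^ n)) n x) | x <- take n (enum 'I_(2 ^ n))].

Lemma size_chain n : size (chain n) = n.
Proof. by rewrite size_map size_iota. Qed.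

Lemma uniq_chain n : uniq (chain n).
Proof.
rewrite map_inj_uniq ?iota_uniq// => k l [kl].
by move/eqP: kl => /eqP.
Qed.

Lemma size_level_family n : size (level_family n) = n.
Proof.
rewrite size_map size_take size_enum_ord; case: ltnP => // h.
by apply/eqP; rewrite eqn_leq h/= ltnW// ltn_expl.
Qed.

Lemma uniq_level_family n : uniq (level_family n).
Proof.
rewrite map_inj_uniq ?take_uniq ?enum_uniq// => x y /Some_inj xy.
by apply: val_inj; have := congr1 (fun Q => position (Some Q)) xy.
Qed.

Lemma chain_level_family_disjoint n j : j \in chain n -> j \in level_family n -> false.
Proof.
move=> /mapP[k]; rewrite mem_iota add0n => /andP[_ kn] -> /mapP[l _] [kn'].
by rewrite kn' ltnn in kn.
Qed.

Lemma Lnorm_chi p n k : 0 < p -> (k < 2 ^ n)%N ->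
  ('N_p[(chi n k : R -> R)] = ((2 ^- n) `^ p^-1)%:E)%E.
Proof.
move=> p0 kn; rewrite Lnorm_realE -poweR_EFin -(integral_chi R kn); congr (_ `^ _)%E.
apply: eq_integral => t _; congr EFin.
rewrite /chi indicE; case: (t \in _); first by rewrite normr1 powR1.
by rewrite normr0 powR0// gt_eqF.
Qed.

Lemma disjoint_sum_powR (I : eqType) (s : seq I) (f : I -> R) p : 0 < p ->
    uniq s -> {in s &, forall x y, x != y -> f x * f y = 0} ->
  `|\sum_(x <- s) f x| `^ p = \sum_(x <- s) `|f x| `^ p.
Proof.
move=> p0 us fs; have z : `|0 : R| `^ p = 0 by rewrite normr0 powR0// gt_eqF.
have [/hasP[i is_ fi]|/hasPn h] := boolP (has (fun x => f x != 0) s).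
  have f0 (j : I) : j \in s -> j != i -> f j = 0.
    move=> js ji; have /eqP := fs _ _ js is_ ji.
    by rewrite mulf_eq0 (negbTE fi) orbF => /eqP.
  have s1 : \sum_(x <- s | x != i) f x = 0.
    by rewrite big_seq_cond big1// => x /andP[xs xi]; rewrite f0.
  have s2 : \sum_(x <- s | x != i) `|f x| `^ p = 0.
    by rewrite big_seq_cond big1// => x /andP[xs xi]; rewrite f0 ?z.
  by rewrite (bigD1_seq i)//= [RHS](bigD1_seq i)//= s1 s2 !addr0.
have f0 (j : I) : j \in s -> f j = 0 by move=> /h /negPn/eqP.
rewrite big_seq big1; last by move=> x xs; rewrite f0.
by rewrite z big_seq big1// => x xs; rewrite f0.
Qed.

Lemma Lnorm_level_family p n : 0 < p ->
  ('N_p[(fun t => \sum_(j <- level_family n) haar p j t)%R] = (n%:R `^ p^-1)%:E)%E.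
Proof.
move=> p0; rewrite Lnorm_realE.
under eq_integral => t _.
  rewrite disjoint_sum_powR//; [|exact: uniq_level_family|]; last first.
    move=> _ _ /mapP[k _ ->] /mapP[l _ ->] kl.
    by apply: haarM_same_level => //; apply: contra_neq kl => ->.
  over.
by rewrite integral_sum_normr_haar_powR// size_level_family poweR_EFin.
Qed.

Local Notation tail k := (chi k (2 ^ k).-1 : R -> R).

Lemma haar_chain p k t :
  haar p (chain_index k) t = haar_scale p k * (2 * tail k.+1 t - tail k t).
Proof.
rewrite haar_SomeE /=; congr (_ * _).
have := chi_halves k (2 ^ k).-1 t.
have -> : (2 ^ k).-1.*2.+1 = (2 ^ k.+1).-1.
  rewrite expnS mul2n -[in RHS](@prednK (2 ^ k)) ?expn_gt0//.
by move=> <-; ring.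
Qed.

Lemma tailM k n t : (k <= n)%N -> tail k t * tail n t = tail n t.
Proof.
move=> kn; rewrite chiM//; set e := (_ == _).
suff -> : e by rewrite mul1r.
rewrite /e; apply/eqP; set D := (2 ^ (n - k))%N.
have D0 : (0 < D)%N by rewrite expn_gt0.
have k0 : (0 < 2 ^ k)%N by rewrite expn_gt0.
have -> : (2 ^ n).-1 = ((2 ^ k).-1 * D + D.-1)%N.
  have -> : (2 ^ n = 2 ^ k * D)%N by rewrite -expnD subnKC.
  by rewrite -{1}(prednK k0) mulSn -{1}(prednK D0) addSn /= addnC.
by rewrite divnMDl// divn_small ?addn0// prednK.
Qed.

(** All the functions of the chain are positive on its innermost interval,
    where their sum is at least their number. *)
Lemma Lnorm_chain_ge p n : 0 < p ->
  ((n%:R * (2 ^- n) `^ p^-1)%:E <=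
    'N_p[(fun t => \sum_(j <- chain n) haar p j t)%R])%E.
Proof.
move=> p0; rewrite EFinM -(Lnorm_chi p0 (pred_expn2_lt n)).
rewrite -Lnorm_scale//; last exact: measurable_chi.
apply: le_Lnorm; [exact: ltW| | |].
- by apply: measurable_funM => //; exact: measurable_chi.
- by apply: measurable_sum => j; exact: measurable_haar.
move=> t; rewrite ger0_norm ?mulr_ge0 ?chi_ge0//.
apply: (@le_trans _ _ ((\sum_(j <- chain n) haar p j t) * tail n t)).
  rewrite mulr_suml big_map big_seq.
  rewrite (eq_bigr (fun k => haar_scale p k * tail n t)); last first.
    move=> k; rewrite mem_iota add0n => /andP[_ kn].
    by rewrite haar_chain -mulrA mulrBl -mulrA !tailM// 1?ltnW//; ring.
  rewrite -big_seq -mulr_suml ler_wpM2r ?chi_ge0//.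
  rewrite -{1}(size_iota 0 n) -sum1_size natr_sum; apply: ler_sum => k _.
  rewrite haar_scale_exp exprn_ege1// powR_expR -[leLHS]expR0 ler_expR.
  by rewrite mulr_ge0 ?invr_ge0 ?ltW//; apply: lt_le_trans (ln2_ge_half R).
apply: le_trans (ler_norm _) _.
by rewrite normrM (ger0_norm (chi_ge0 _ _ _)) ler_piMr// chi_le1.
Qed.

(** Summation by parts: the tail of level [k.+1] enters the terms of level [k]
    and [k.+1] with opposite signs. *)
Lemma sum_chainE p n t : \sum_(j <- chain n) haar p j t =
  - tail 0 t + (2 - 2 `^ p^-1) * \sum_(0 <= k < n) haar_scale p k * tail k.+1 t
  + haar_scale p n * tail n t.
Proof.
rewrite big_map (_ : iota 0 n = index_iota 0 n); last by rewrite /index_iota subn0.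
elim: n => [|n IH].
  by rewrite !big_geq// /haar_scale expr0 powR1; ring.
rewrite !big_nat_recr// IH haar_chain haar_scaleS /=; ring.
Qed.

(** In [sum_chainE] the two boundary terms have norm 1, and the middle sum is
    dominated by the sum of the absolute values of the chain; its coefficient
    [2 - 2 `^ p^-1 = 2 * (1 - 2 `^ (- p'^-1))] is at most [2 / p']. *)
Lemma Lnorm_chain_le p n : 1 < p ->
  ('N_p[(fun t => \sum_(j <- chain n) haar p j t)%R] <=
   (2 + 2 / conj_exponent p * (8 * p * n%:R `^ p^-1))%:E)%E.
Proof.
move=> p1; have p0 : 0 < p by lra.
set c := 2 / conj_exponent p.
have q1 := conj_exponent_gt1 p1.
have c0 : 0 <= c by rewrite divr_ge0//; lra.
have gap : `|2 - 2 `^ p^-1| <= c.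
  have pV : p^-1 = 1 - (conj_exponent p)^-1.
    by rewrite -(conj_exponentP p1) addrK.
  rewrite pV powRD; last by rewrite pnatr_eq0 implybT.
  rewrite powRr1// -[X in X - _]mulr1 -mulrBr normrM ger0_norm// ler_wpM2l//.
  rewrite powR_expR; set x := (conj_exponent p)^-1.
  have x0 : 0 <= x by rewrite invr_ge0; lra.
  have l0 : 0 <= ln (2 : R) by have := ln2_ge_half R; lra.
  have : expR (- x * ln 2) <= 1.
    by rewrite -[leRHS]expR0 ler_expR mulNr oppr_le0 mulr_ge0.
  have := expR_ge1Dx (- x * ln 2).
  have := ler_wpM2l x0 (ln2_le1 R).
  by rewrite mulr1 ler_norml => *; apply/andP; split; lra.
have mt k : measurable_fun setT (tail k) by exact: measurable_chi.
have sn0 k : 0 <= haar_scale p k by rewrite ltW// haar_scale_gt0.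
have mS := measurable_sum_normr_haar p (chain n).
have mL : measurable_fun setT (fun t => haar_scale p n * tail n t).
  exact: measurable_funM.
have mc : measurable_fun setT (fun t => c * sum_normr_haar p (chain n) t).
  exact: measurable_funM.
pose g := ((tail 0 \+ (fun t => haar_scale p n * tail n t)) \+
           (fun t => c * sum_normr_haar p (chain n) t))%R.
have mg1 : measurable_fun setT (tail 0 \+ (fun t => haar_scale p n * tail n t))%R.
  exact: measurable_funD.
apply: (@le_trans _ _ ('N_p[g])%E).
  apply: le_Lnorm; [exact: ltW| |exact: measurable_funD|].
    by apply: measurable_sum => j; exact: measurable_haar.
  move=> t; rewrite [leRHS]ger0_norm; last first.
    apply: addr_ge0; last by apply: mulr_ge0 => //; exact: sumr_ge0.
    by apply: addr_ge0; [|apply: mulr_ge0 => //]; exact: chi_ge0.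
  rewrite sum_chainE /g /= addrAC; apply: le_trans (ler_normD _ _) _.
  apply: lerD.
    apply: le_trans (ler_normD _ _) _; rewrite normrN !ger0_norm ?chi_ge0//.
    by rewrite mulr_ge0 ?chi_ge0.
  rewrite normrM ler_pM// ger0_norm; last first.
    by apply: sumr_ge0 => k _; rewrite mulr_ge0 ?chi_ge0.
  rewrite /sum_normr_haar big_map /index_iota subn0.
  apply: ler_sum => k _; rewrite normr_haar /= ler_wpM2l//.
  by rewrite -(tailM t (leqnSn k)) ler_piMr ?chi_ge0 ?chi_le1.
apply: le_trans (minkowski_EFin mu mg1 mc (ltW p1)) _.
rewrite EFinD; apply: leeD.
  apply: le_trans (minkowski_EFin mu (mt 0) mL (ltW p1)) _.
  rewrite Lnorm_scale// !Lnorm_chi ?pred_expn2_lt//.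
  rewrite -EFinM -EFinD lee_fin expr0 invr1 powR1 /haar_scale -powRM;
    rewrite ?invr_ge0 ?exprn_ge0//.
  by rewrite divff ?powR1 // gt_eqF// exprn_gt0.
rewrite Lnorm_scale// [leRHS]EFinM.
apply: lee_wpmul2l; first by rewrite lee_fin.
have := Lnorm_sum_normr_haar_le (ltW p1) (uniq_chain n).
by rewrite size_chain.
Qed.

End Examples.

(** * The democracy constants *)
Section Comparison.
Context (R : realType).

Lemma le_smallest_constant (P : R -> Prop) (c : R) :
  (forall C, 0 <= C -> P C -> c <= C) -> (c%:E <= smallest_constant P)%E.
Proof.
by move=> h; apply/ereal_infP => _ [C [C0 PC] <-]; rewrite lee_fin h.
Qed.

Lemma smallest_constant_le (P : R -> Prop) (C : R) :
  0 <= C -> P C -> (smallest_constant P <= C%:E)%E.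
Proof. by move=> C0 PC; apply: ereal_inf_lbound; exists C. Qed.

Lemma le_smallest_constants (P Q : R -> Prop) :
  (forall C, 0 <= C -> Q C -> P C) ->
  (smallest_constant P <= smallest_constant Q)%E.
Proof.
move=> QP; apply/ereal_infP => _ [C [C0 QC] <-].
by apply: smallest_constant_le => //; exact: QP.
Qed.

Lemma approx_upto_constants_of_bounds (w : R -> R) (c C : R)
    (alpha beta : R -> \bar R) : 0 < c -> c <= C ->
    (forall p, 1 < p -> 0 <= w p) ->
    (forall p, 1 < p -> ((c * w p)%:E <= alpha p <= (C * w p)%:E)%E) ->
    (forall p, 1 < p -> ((c * w p)%:E <= beta p <= (C * w p)%:E)%E) ->
  approx_upto_constants alpha beta.
Proof.
move=> c0 cC w0 ha hb; have C0 : 0 < C by lra.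
exists (c / C), (C / c); split; first exact: divr_gt0.
  rewrite ler_pdivrMr// mulrAC ler_pdivlMr//; nra.
move=> p p1; have /andP[a1 a2] := ha p p1; have /andP[b1 b2] := hb p p1.
have Cc0 : (0 <= (C / c)%:E)%E by rewrite lee_fin divr_ge0// ltW.
have cC0 : (0 <= (c / C)%:E)%E by rewrite lee_fin divr_ge0// ltW.
split.
  apply: le_trans (lee_wpmul2l cC0 b2) _; apply: le_trans a1.
  by rewrite -EFinM lee_fin mulrA divfK// gt_eqF.
apply: le_trans a2 _; apply: le_trans (lee_wpmul2l Cc0 b1).
by rewrite -EFinM lee_fin mulrA divfK// gt_eqF.
Qed.

End Comparison.

Section HaarConstants.
Context (R : realType) (F : scalars).
Implicit Types (p : R) (A B : {fset haar_index}).

Local Notation mu := (@unit_interval_measure R).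
Local Notation "'N_ p [ f ]" := (Lnorm mu p%:E (EFin \o f)) : ereal_scope.
Local Notation "p ^star" := (Num.max p (conj_exponent p)) (at level 2) : ring_scope.

Lemma sum_haar_system p (s : seq haar_index) :
  \sum_(j <- s) haar_system F p j = haar_sum p s (fun=> 1).
Proof. by apply: eq_bigr => j _; rewrite scale1r. Qed.

Lemma Lp_norm_sum_haar_system p (s : seq haar_index) :
  Lp_norm p (\sum_(j <- s) haar_system F p j) =
  ('N_p[(fun t => \sum_(j <- s) haar p j t)%R])%E.
Proof.
rewrite sum_haar_system -Lnorm_abse; apply: eq_Lnorm => t /=; congr EFin.
rewrite modulusE re_part_haar_sum im_part_haar_sum -sqrtr_sqr.
congr Num.sqrt; rewrite [X in _ + X ^+ 2]big1; last first.
  by move=> j _; rewrite /im_part; case: F => /=; rewrite mul0r.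
rewrite expr0n addr0; congr (_ ^+ 2); apply: eq_bigr => j _.
by rewrite /re_part; case: F => /=; rewrite mul1r.
Qed.

Lemma exponent_prod_le p : 1 < p -> p * conj_exponent p <= 2 * p ^star.
Proof.
move=> p1.
have -> : p * conj_exponent p = p + conj_exponent p.
  by rewrite /conj_exponent; field; lra.
by rewrite mulr_natl mulr2n lerD// le_max lexx ?orbT.
Qed.

(** The upper bound for [A] and the lower bound for [B] multiply to
    [8 * p * 16 * p'], and [p * p' = p + p']. *)
Lemma haar_superdemocracy_upper p : 1 < p ->
  (haar_superdemocracy F p <= (256 * p ^star)%:E)%E.
Proof.
move=> p1; have q1 := conj_exponent_gt1 p1.
have pq := exponent_prod_le p1.
apply: smallest_constant_le; first by nra.
move=> A B eps delta AB e1 d1.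
have up := Lp_norm_haar_sum_le p1 (fset_uniq A) e1.
have lo := Lp_norm_haar_sum_ge p1 (fset_uniq B) d1.
apply: le_trans up _; rewrite AB EFinM.
have p8 : (0 <= (8 * p)%:E)%E by rewrite lee_fin; lra.
apply: le_trans (lee_wpmul2l p8 lo) _.
rewrite muleA; apply: lee_wpmul2r; first exact: Lnorm_ge0.
by rewrite -EFinM lee_fin; nra.
Qed.

(** The factors [m `^ p^-1] and [m `^ p'^-1] of the two upper bounds multiply to
    [m], which leaves [8 * p * 16 * p'] again. *)
Lemma haar_bidemocracy_upper p : 1 < p ->
  (haar_bidemocracy F p <= (256 * p ^star)%:E)%E.
Proof.
move=> p1; have q1 := conj_exponent_gt1 p1.
have pq := exponent_prod_le p1.
apply: smallest_constant_le; first by nra.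
move=> A B m Am Bm; rewrite sum_haar_system.
have up := Lp_norm_haar_sum_le p1 (fset_uniq A) (unimodular1 R F).
have dual := @dual_norm_haar_coord_le R F p _ p1 (fset_uniq B).
rewrite Am in up; rewrite Bm in dual.
apply: le_trans (lee_wpmul2l _ dual) _; first exact: Lnorm_ge0.
have dual0 : (0 <= (16 * conj_exponent p * m%:R `^ (conj_exponent p)^-1)%:E)%E.
  by rewrite lee_fin mulr_ge0 ?powR_ge0// mulr_ge0//; lra.
apply: le_trans (lee_wpmul2r dual0 up) _.
rewrite -EFinM lee_fin mulrACA powR_conj_split// ler_wpM2r//.
by nra.
Qed.

(** The dual norm of the sum over [B] is at least [m] over the norm of the sum
    of the basis vectors, so dividing by it turns the bi-democracy inequality
    into the democracy inequality with the same constant. *)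
Lemma haar_democracy_le_bidemocracy p : 1 < p ->
  (haar_democracy F p <= haar_bidemocracy F p)%E.
Proof.
move=> p1; have q1 := conj_exponent_gt1 p1.
apply: le_smallest_constants => C C0 hC A B AB.
rewrite !sum_haar_system.
have upA := Lp_norm_haar_sum_le p1 (fset_uniq A) (unimodular1 R F).
have [B0|B0] := posnP (size B).
  apply: le_trans upA _; rewrite AB B0 powR0 ?mulr0; last first.
    by rewrite invr_eq0; lra.
  by apply: mule_ge0; [rewrite lee_fin|exact: Lnorm_ge0].
have loB := Lp_norm_haar_sum_ge p1 (fset_uniq B) (unimodular1 R F).
have upB := Lp_norm_haar_sum_le p1 (fset_uniq B) (unimodular1 R F).
have := hC A B _ AB erefl; rewrite sum_haar_system => /(le_trans
  (lee_wpmul2l (Lnorm_ge0 _ _ _) (dual_norm_haar_coord_ge F p1 (fset_uniq B) B0))).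
set a := Lp_norm p (haar_sum p A _) in upA *.
set b := Lp_norm p (haar_sum p B _) in loB upB *.
have afin : a \is a fin_num.
  by rewrite ge0_fin_numE ?Lnorm_ge0//; exact: le_lt_trans upA (ltry _).
have bfin : b \is a fin_num.
  by rewrite ge0_fin_numE ?Lnorm_ge0//; exact: le_lt_trans upB (ltry _).
have b0 : 0 < fine b.
  have : 0 < 16 * conj_exponent p * fine b.
    move: loB; rewrite -(fineK bfin) -EFinM lee_fin; apply: lt_le_trans.
    by rewrite powR_gt0// ltr0n.
  by rewrite pmulr_rgt0//; lra.
rewrite -[X in (X * _ <= _)%E](fineK afin) -(fineK afin) -(fineK bfin).
rewrite -!EFinM !lee_fin /=.
rewrite mulrA mulrAC ler_pM2r ?ltr0n//.
by rewrite ler_pdivrMr.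
Qed.

Lemma haar_disjoint_democracy_le_democracy p :
  (haar_disjoint_democracy F p <= haar_democracy F p)%E.
Proof. by apply: le_smallest_constants => C C0 hC A B AB _; exact: hC. Qed.

Lemma haar_disjoint_democracy_le_disjoint_superdemocracy p :
  (haar_disjoint_democracy F p <= haar_disjoint_superdemocracy F p)%E.
Proof.
apply: le_smallest_constants => C C0 hC A B AB dAB; rewrite !sum_haar_system.
by apply: hC => //; exact: unimodular1.
Qed.

Lemma haar_disjoint_superdemocracy_le_superdemocracy p :
  (haar_disjoint_superdemocracy F p <= haar_superdemocracy F p)%E.
Proof. by apply: le_smallest_constants => C C0 hC A B e d AB _; exact: hC. Qed.

Lemma haar_democracy_le_superdemocracy p :
  (haar_democracy F p <= haar_superdemocracy F p)%E.
Proof.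
apply: le_smallest_constants => C C0 hC A B AB; rewrite !sum_haar_system.
by apply: hC => //; exact: unimodular1.
Qed.

Lemma disjoint_democracy_seq p (C : R) (s s' : seq haar_index) :
    (forall A B, #|` A| = #|` B| -> [disjoint A & B]%fset ->
       (Lp_norm p (\sum_(j <- A) haar_system F p j)%R <=
        C%:E * Lp_norm p (\sum_(j <- B) haar_system F p j)%R)%E) ->
    uniq s -> uniq s' -> size s = size s' ->
    (forall j, j \in s -> j \in s' -> false) ->
  ('N_p[(fun t => \sum_(j <- s) haar p j t)%R] <=
   C%:E * 'N_p[(fun t => \sum_(j <- s') haar p j t)%R])%E.
Proof.
move=> hC us us' ss' dss'.
have ps : perm_eq (seq_fset tt s) s by rewrite -{2}(undup_id us) seq_fset_perm.
have ps' : perm_eq (seq_fset tt s') s'.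
  by rewrite -{2}(undup_id us') seq_fset_perm.
have := hC (seq_fset tt s) (seq_fset tt s').
rewrite (perm_size ps) (perm_size ps') (perm_big _ ps) (perm_big _ ps').
rewrite !Lp_norm_sum_haar_system; apply=> //.
apply/fdisjointP => j; rewrite !seq_fsetE => js.
by apply/negP => js'; have := dss' j js js'.
Qed.

(** For suitable [n], compared with [n `^ p^-1], the norm of a sum of [n] Haar
    functions of one level, the norm of the chain sum is too large by a factor of order [p] when
    [p >= 2] and too small by a factor of order [p'] when [p < 2]. *)
Lemma haar_disjoint_democracy_lower p : 1 < p ->
  ((34^-1 * p ^star)%:E <= haar_disjoint_democracy F p)%E.
Proof.
move=> p1; have q1 := conj_exponent_gt1 p1; have p0 : 0 < p by lra.
apply: le_smallest_constant => C C0 hC; rewrite mulrC ler_pdivrMr//.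
have [p2|p2] := leP 2 p.
- have -> : p ^star = p.
    by apply/max_idPl; rewrite /conj_exponent ler_pdivrMr; [nra|lra].
  (* [n] between [p] and [2 * p]: the chain sum reaches [n >= p], while the
     [p]-th root of the measure [2 ^- n] is still at least 1/4. *)
  pose n := (Num.truncn p).+1.
  have pn : p < n%:R by rewrite truncnS_gt.
  have np : n%:R <= 2 * p.
    have : (Num.truncn p)%:R <= p by rewrite truncn_le// ltW.
    by rewrite /n -natr1; lra.
  have root4 : (2 ^+ n) `^ p^-1 <= 4 :> R.
    have -> : 4 = (2 `^ (2 * p)) `^ p^-1 :> R.
      by rewrite -powRrM mulfK ?gt_eqF// powR_mulrn// -natrX.
    apply: ge0_ler_powR; rewrite ?nnegrE ?invr_ge0 ?powR_ge0 ?exprn_ge0 ?(ltW p0)//.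
    by rewrite -powR_mulrn// ler_powR// ler1n.
  have rootn : n%:R `^ p^-1 <= 4 :> R.
    apply: le_trans root4.
    apply: ge0_ler_powR; rewrite ?nnegrE ?invr_ge0 ?exprn_ge0 ?(ltW p0)//.
    by rewrite -natrX ler_nat ltnW// ltn_expl.
  have := disjoint_democracy_seq hC (uniq_chain n) (uniq_level_family n).
  rewrite size_chain size_level_family Lnorm_level_family//.
  move=> /(_ erefl (@chain_level_family_disjoint n)).
  move=> /(le_trans (Lnorm_chain_ge n p0)); rewrite -EFinM lee_fin.
  have -> : (2 ^- n) `^ p^-1 = ((2 ^+ n) `^ p^-1)^-1 :> R.
    by rewrite -[RHS]powR_inv1 ?powR_ge0// -powRrM mulrC powRrM powR_inv1// exprn_ge0.
  set r := (2 ^+ n) `^ p^-1 in root4 *.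
  have r0 : 0 < r by rewrite powR_gt0// exprn_gt0.
  rewrite ler_pdivrMr//.
  set m := n%:R `^ _ in rootn *.
  have m0 : 0 <= m by exact: powR_ge0.
  move=> h; have : C * m * r <= C * 16.
    rewrite -mulrA ler_wpM2l//; nra.
  lra.
- have -> : p ^star = conj_exponent p.
    by apply/max_idPr; rewrite /conj_exponent ler_pdivlMr; nra.
  set q := conj_exponent p in q1 *.
  (* With [n >= q ^+ 2 >= q `^ p], the term [2] of [Lnorm_chain_le] is absorbed:
     [2 + 32 * n `^ p^-1 / q] is at most [34 * n `^ p^-1 / q]. *)
  pose n := (Num.truncn (q ^+ 2)).+1.
  have qn : q <= n%:R `^ p^-1.
    have : q ^+ 2 <= n%:R by rewrite ltW// truncnS_gt.
    move=> h; apply: (@le_trans _ _ ((q `^ p) `^ p^-1)).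
      by rewrite -powRrM divff ?gt_eqF// powRr1//; lra.
    apply: ge0_ler_powR; rewrite ?nnegrE ?invr_ge0 ?powR_ge0 ?(ltW p0)//.
    apply: le_trans h; rewrite -powR_mulrn; last by lra.
    by apply: ler_powR; lra.
  have := disjoint_democracy_seq hC (uniq_level_family n) (uniq_chain n).
  rewrite size_chain size_level_family Lnorm_level_family// => /(_ erefl).
  move=> /(_ (fun j jr jc => @chain_level_family_disjoint n j jc jr)).
  have CE : (0 <= C%:E)%E by rewrite lee_fin.
  move=> /le_trans/(_ (lee_wpmul2l CE (Lnorm_chain_le n p1))).
  rewrite -EFinM lee_fin -/q.
  set m := n%:R `^ _ in qn *.
  have q0 : 0 < q by lra.
  have -> : 2 + 2 / q * (8 * p * m) = (2 * q + 16 * p * m) / q.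
    by field; rewrite gt_eqF.
  rewrite mulrA ler_pdivlMr// => h.
  have m0 : 0 < m by lra.
  rewrite -(ler_pM2l m0); apply: le_trans h _.
  have : C * (2 * q + 16 * p * m) <= C * (34 * m).
    by rewrite ler_wpM2l//; nra.
  lra.
Qed.

End HaarConstants.

Theorem corollary3p2 (R : realType) (F : scalars) :
  [/\ approx_upto_constants (@haar_bidemocracy R F) (haar_superdemocracy F),
      approx_upto_constants (@haar_superdemocracy R F) (haar_disjoint_superdemocracy F),
      approx_upto_constants (@haar_disjoint_superdemocracy R F) (haar_democracy F),
      approx_upto_constants (@haar_democracy R F) (haar_disjoint_democracy F) &
      approx_upto_constants (@haar_disjoint_democracy R F)
        (fun p => (Num.max p (conj_exponent p))%:E)].
Proof.
pose w (p : R) := Num.max p (conj_exponent p).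
have w0 p : 1 < p -> 0 <= w p by rewrite /w le_max; lra.
have c0 : 0 < 34^-1 :> R by rewrite invr_gt0.
have cC : 34^-1 <= 256 :> R by lra.
have lo (p : R) (p1 : 1 < p) := haar_disjoint_democracy_lower F p1.
have up (p : R) (p1 : 1 < p) := haar_superdemocracy_upper F p1.
have dd := @haar_disjoint_democracy_le_democracy R F.
have dsd := @haar_disjoint_democracy_le_disjoint_superdemocracy R F.
have sds := @haar_disjoint_superdemocracy_le_superdemocracy R F.
have ds := @haar_democracy_le_superdemocracy R F.
have bd (p : R) : 1 < p ->
    ((34^-1 * w p)%:E <= haar_bidemocracy F p <= (256 * w p)%:E)%E.
  move=> p1; apply/andP; split; last exact: haar_bidemocracy_upper.
  apply: le_trans (lo p p1) _; apply: le_trans (dd p) _.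
  exact: haar_democracy_le_bidemocracy.
have bs (p : R) : 1 < p ->
    ((34^-1 * w p)%:E <= haar_superdemocracy F p <= (256 * w p)%:E)%E.
  move=> p1; apply/andP; split; last exact: up.
  exact: le_trans (lo p p1) (le_trans (dd p) (ds p)).
have bsd (p : R) : 1 < p ->
    ((34^-1 * w p)%:E <= haar_disjoint_superdemocracy F p <= (256 * w p)%:E)%E.
  move=> p1; apply/andP; split; first exact: le_trans (lo p p1) (dsd p).
  exact: le_trans (sds p) (up p p1).
have bdem (p : R) : 1 < p ->
    ((34^-1 * w p)%:E <= haar_democracy F p <= (256 * w p)%:E)%E.
  move=> p1; apply/andP; split; first exact: le_trans (lo p p1) (dd p).
  exact: le_trans (ds p) (up p p1).
have bdd (p : R) : 1 < p ->
    ((34^-1 * w p)%:E <= haar_disjoint_democracy F p <= (256 * w p)%:E)%E.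
  move=> p1; apply/andP; split; first exact: lo.
  exact: le_trans (dd p) (le_trans (ds p) (up p p1)).
split; try exact: (approx_upto_constants_of_bounds c0 cC w0).
apply: (approx_upto_constants_of_bounds c0 cC w0) => // p p1.
have wp := w0 p p1.
by rewrite !lee_fin -/(w p); apply/andP; split; lra.
Qed.
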